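(* Let $\mathfrak{g}=\mathfrak{g}_1\oplus\mathfrak{g}_2$ be a $6$-dimensional real non-nilpotent Lie algebra (not necessarily solvable) that is a direct sum of Lie algebras with $\dim\mathfrak{g}_1=4$ and $\dim\mathfrak{g}_2=2$. Then $\mathfrak{g}$ does not admit any symplectic half-flat structure.
   Context: $d$ denotes the Chevalley-Eilenberg differential of $\mathfrak{g}$ and $f^{ij}=f^i\wedge f^j$. SU(3) structures. Let $V$ be an oriented $6$-dimensional real vector space. Let $\kappa:\Lambda^5V^*\to V\otimes\Lambda^6V^*$ be the isomorphism $\kappa(\eta)=X\otimes\nu$ with $\iota_X\nu=\eta$. For $\rho\in\Lambda^3V^*$ let $K_\rho:V\to V\otimes\Lambda^6V^*$, $K_\rho(X)=\kappa(\iota_X\rho\wedge\rho)$, and $\lambda(\rho)=\frac16\mathrm{tr}(K_\rho^2)\in(\Lambda^6V^* )^{\otimes 2}$. The form $\rho$ is stable iff $\lambda(\rho)\neq0$; put $\phi(\rho)=\sqrt{|\lambda(\rho)|}\in\Lambda^6V^*$ (the positively oriented root). If $\lambda(\rho)<0$, then $J_\rho=\frac{1}{\phi(\rho)}K_\rho$ is an almost complex structure. A $2$-form $F$ is stable if $F^3\neq0$; put $\phi(F)=\frac16F^3$. An SU(3) structure on $V$ is a pair $(F,\rho)\in\Lambda^2V^*\times\Lambda^3V^*$ of stable forms with $\lambda(\rho)<0$ that is compatible ($F\wedge\rho=0$), normalized ($\phi(\rho)=2\phi(F)$) and such that the bilinear form $g(\cdot,\cdot)=F(J_\rho\cdot,\cdot)$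 is positive definite. Equivalently, there is a basis $f^1,\dots,f^6$ of $V^*$ with $F=f^{12}+f^{34}+f^{56}$ and $\rho=\mathrm{Re}\big((f^1+if^2)\wedge(f^3+if^4)\wedge(f^5+if^6)\big)$. A symplectic half-flat structure on a $6$-dimensional Lie algebra $\mathfrak{g}$ is an SU(3) structure $(F,\rho)$ on the vector space $\mathfrak{g}$ with $dF=0$ and $d\rho=0$. *)

(* Defs.v *)
From HB Require Import structures.
From mathcomp Require Import all_boot all_order all_algebra all_fingroup.
From mathcomp Require Import boolp classical_sets reals.

Set Implicit Arguments.
Unset Strict Implicit.
Unset Printing Implicit Defensive.

Import Order.TTheory GRing.Theory Num.Theory.
Local Open Scope ring_scope.

HB.mixin Record Vector_isLieAlgebra (K : fieldType) V of Vector K V := {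
  lie : V -> V -> V;
  lie_linearl : forall z, linear (fun x => lie x z);
  lie_linearr : forall x, linear (lie x);
  liexx : forall x, lie x x = 0;
  lie_jacobi : forall x y z,
    lie x (lie y z) + lie y (lie z x) + lie z (lie x y) = 0
}.

#[short(type="lieAlgType")]
HB.structure Definition LieAlgebra (K : fieldType) :=
  { V of Vector_isLieAlgebra K V & Vector K V }.

Section LieAlgebraTheory.
Variables (K : fieldType) (g : lieAlgType K).
Implicit Types U W : {vspace g}.

Definition lier (z x : g) : g := lie x z.

HB.instance Definition _ (x : g) :=
  GRing.isLinear.Build K g g *:%R (lie x) (lie_linearr x).
HB.instance Definition _ (z : g) :=
  GRing.isLinear.Build K g g *:%R (lier z) (lie_linearl z).

(* [U, W]: by bilinearity, brackets of basis vectors suffice (see memv_lie). *)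
Definition liev U W : {vspace g} :=
  <<[seq lie x y | x <- vbasis U, y <- vbasis W]>>%VS.

Lemma memv_lie U W x y : x \in U -> y \in W -> lie x y \in liev U W.
Proof.
move=> Ux Wy; rewrite (coord_vbasis Ux) (coord_vbasis Wy) linear_sum /=.
apply: memv_suml => j _; rewrite linearZ memvZ //= -/(lier _ _) linear_sum /=.
apply: memv_suml => i _; rewrite linearZ memvZ //=; apply: memv_span.
by apply: allpairs_f; apply: mem_nth; rewrite size_tuple.
Qed.

Fixpoint lower_central (k : nat) : {vspace g} :=
  if k is k'.+1 then liev fullv (lower_central k') else fullv.

Definition lie_nilpotent : Prop := exists k, lower_central k = 0%VS.

Definition lie_ideal U : Prop := (liev fullv U <= U)%VS.

(* Internal direct sum of Lie algebras; two ideals that meet in 0 commute. *)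
Definition lie_direct_sum (g1 g2 : {vspace g}) : Prop :=
  [/\ lie_ideal g1, lie_ideal g2, (g1 + g2 = fullv)%VS & (g1 :&: g2 = 0)%VS].

End LieAlgebraTheory.

(* A k-form is a function on k-tuples of vectors that satisfies [altform]. *)
(* The wedge product is normalized by (f^1 /\ f^2)(x, y) = f^1 x f^2 y - *)
(* f^1 y f^2 x. *)

Section Forms.
Variables (R : fieldType) (V : vectType R).

Definition kform (k : nat) := k.-tuple V -> R.

Definition tupd k (v : k.-tuple V) (i : 'I_k) (x : V) : k.-tuple V :=
  [tuple if j == i then x else tnth v j | j < k].

Definition altform k (a : kform k) : Prop :=
  (forall (v : k.-tuple V) i c x y,
     a (tupd v i (c *: x + y)) = c * a (tupd v i x) + a (tupd v i y)) /\
  (forall (v : k.-tuple V) i j, i != j -> tnth v i = tnth v j -> a v = 0).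

Definition wedgef p q (a : kform p) (b : kform q) : kform (p + q) := fun v =>
  (p`! * q`!)%:R^-1 *
  \sum_(s : 'S_(p + q)) (-1) ^+ s *
    a [tuple tnth v (s (lshift q i)) | i < p] *
    b [tuple tnth v (s (rshift p j)) | j < q].

Definition intprod k (x : V) (a : kform k.+1) : kform k :=
  fun v => a [tuple of x :: v].

Definition lftrace (f : 'End(V)) : R :=
  \tr (passmx.mxof (vbasis {:V}) (vbasis {:V}) f).

End Forms.

Section ChevalleyEilenberg.
Variables (R : fieldType) (g : lieAlgType R).

(* For i < j, [lift j i] has value i, and [lift j (lift i m)] enumerates in *)
(* increasing order the indices distinct from i and j. *)
Definition CEd k (a : kform g k.+1) : kform g k.+2 := fun v =>
  \sum_(j < k.+2) \sum_(i < k.+1 | (i < j)%N) (-1) ^+ (i + j) *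
    a [tuple of lie (tnth v (lift j i)) (tnth v j) ::
                [tuple tnth v (lift j (lift i m)) | m < k]].

Definition CEclosed k (a : kform g k.+1) : Prop := forall v, CEd a v = 0.

End ChevalleyEilenberg.

(* The orientation is given by a nonzero 6-form [vol], positive by definition. *)
(* The line of 6-forms is trivialized by vol: V (x) Lambda^6 V^* is identified *)
(* with V, so that kappa, K_rho and lambda(rho) are the coefficients of vol *)
(* (of vol (x) vol for lambda). Replacing vol by c vol with c > 0 divides *)
(* K_rho by c and lambda(rho) by c ^ 2, and leaves the 6-form phi(rho) and the *)
(* endomorphism J_rho unchanged. *)

Section SU3.
Variables (R : realType) (V : vectType R).

Definition volume_form (vol : kform V 6) : Prop :=
  altform vol /\ exists v, vol v != 0.

Section Oriented.
Variable vol : kform V 6.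

(* For dim V = 6, vol a volume form and eta alternating, X exists and is unique. *)
Definition kappa (eta : kform V 5) : V :=
  xget 0 [set X : V | intprod X vol =1 eta]%classic.

Definition Krho (rho : kform V 3) : 'End(V) :=
  linfun (fun X => kappa (wedgef (intprod X rho) rho)).

Definition lambda3 (rho : kform V 3) : R :=
  6%:R^-1 * lftrace (Krho rho \o Krho rho)%VF.

Definition stable3 (rho : kform V 3) : Prop := lambda3 rho != 0.

Definition phi3 (rho : kform V 3) : kform V 6 :=
  fun v => Num.sqrt `|lambda3 rho| * vol v.

Definition Jrho (rho : kform V 3) : 'End(V) :=
  (Num.sqrt `|lambda3 rho|)^-1 *: Krho rho.

Definition cubef (F : kform V 2) : kform V 6 := wedgef (wedgef F F) F.

Definition stable2 (F : kform V 2) : Prop := exists v, cubef F v != 0.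

Definition phi2 (F : kform V 2) : kform V 6 := fun v => 6%:R^-1 * cubef F v.

Definition su3_metric (F : kform V 2) (rho : kform V 3) (X Y : V) : R :=
  F [tuple Jrho rho X; Y].

Record su3_structure (F : kform V 2) (rho : kform V 3) : Prop := {
  su3_altF : altform F;
  su3_altrho : altform rho;
  su3_stableF : stable2 F;
  su3_stablerho : stable3 rho;
  su3_lambda : lambda3 rho < 0;
  su3_compatible : forall v, wedgef F rho v = 0;
  su3_normalized : forall v, phi3 rho v = 2%:R * phi2 F v;
  su3_posdef : forall X, X != 0 -> 0 < su3_metric F rho X X
}.

End Oriented.
End SU3.

Definition symplectic_half_flat (R : realType) (g : lieAlgType R)
    (vol : kform g 6) (F : kform g 2) (rho : kform g 3) : Prop :=
  [/\ su3_structure vol F rho, CEclosed F & CEclosed rho].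

(* Main.v *)
From HB Require Import structures.
Require Import Defs.
From mathcomp Require Import all_boot all_order all_algebra all_fingroup reals.
From mathcomp Require Import boolp classical_sets.
From mathcomp Require Import ring lra zify.

(** Any symplectic half-flat structure on [g1 + g2] forces [g] to be abelian.
    Write f = F and r = rho. Besides closedness and F /\ rho = 0, the proof only
    uses that f is nondegenerate and that for x <> 0 the 2-form r(x,.,.) is
    nondegenerate on ker f(x,.) / x: indeed vol(K x, v) is (i_x rho /\ rho)(v), and
    K x is transverse to ker f(x,.) because F(K x, x) > 0.

    Let e5, e6 be a basis of g2 with [e5,e6] = eps e6. If f(e5,e6) = 0, then g2 is
    central; picking x in g2 with r(x,W1,W2) = 0 shows that two brackets W1, W2 are
    always proportional, and a bracket with one-dimensional image contradicts
    nondegeneracy at that image unless it is zero.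

    If f(e5,e6) <> 0, the orthogonal H of g2 for f is a 4-dimensional subalgebra
    that commutes with e6, and [e5,x] = k(x) e6 on H. After replacing e5 by
    e5 - kap e6, the forms w1 = f, w2 = r(.,.,e5), w3 = r(.,.,e6) on H are, up to
    scale, a hyperkaehler triple, with d w1 = d w3 = 0, d w2 = k /\ w3 and
    eps w3 exact. If k = 0, a trace of the Jacobi identity is a sum of squares of
    all structure constants, so H is abelian. If k <> 0, then eps <> 0 and w3 is
    an exact symplectic form, which the Jacobi identity excludes in a frame adapted
    to k. *)

Set Implicit Arguments.
Unset Strict Implicit.
Unset Printing Implicit Defensive.

Import Order.TTheory GRing.Theory Num.Theory.
Local Open Scope ring_scope.

(** * Alternating forms *)

(** A permutation amounts to the image j of [ord0] and a permutation of the rest, glued by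
    [lift_perm]. Injectivity of the gluing is checked by hand; bijectivity follows by counting. *)
Lemma sum_permS (K : pzRingType) n (G : 'S_n.+1 -> K) :
  \sum_s G s = \sum_(j < n.+1) \sum_(s : 'S_n) G (lift_perm ord0 j s).
Proof.
pose h (p : 'I_n.+1 * 'S_n) := lift_perm ord0 p.1 p.2.
have inj_h : injective h.
  move=> [i s] [j t]; rewrite /h /= => eq_h.
  have ij : i = j by rewrite -(lift_perm_id ord0 i s) eq_h lift_perm_id.
  rewrite -ij in eq_h *; congr (_, _); apply/permP=> k; apply: (@lift_inj _ i).
  by rewrite -(lift_perm_lift ord0 i s) eq_h lift_perm_lift.
have bij_h : bijective h.
  by apply: inj_card_bij inj_h _; rewrite card_prod !card_Sn card_ord factS.
by rewrite (reindex h) ?pair_big //; apply: onW_bij.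
Qed.

(** A signed sum over permutations, unfolded one argument at a time so that it can be evaluated for
    a concrete n. [G] takes a list, so that a chosen vector is simply prepended. *)
Fixpoint altsum (K : pzRingType) (T : Type) n : ('I_n -> T) -> (seq T -> K) -> K :=
  if n is n'.+1 then fun v G =>
    \sum_(j < n'.+1) (-1) ^+ j * altsum (fun i => v (lift j i)) (fun l => G (v j :: l))
  else fun _ G => G [::].

(** Induction on n: the sign of [lift_perm ord0 j s] is (-1)^j times the sign of s. *)
Lemma altsumE (K : pzRingType) (T : Type) n (v : 'I_n -> T) (G : seq T -> K) :
  \sum_(s : 'S_n) (-1) ^+ s * G [seq v (s i) | i <- enum 'I_n] = altsum v G.
Proof.
elim: n v G => [|n IHn] v G /=.
  rewrite (eq_bigr (fun=> G [::])) => [|s _]; last first.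
    have -> : enum 'I_0 = [::] by apply: size0nil; rewrite size_enum_ord.
    suff -> : s = 1%g by rewrite odd_perm1 mul1r.
    by apply/permP; case.
  by rewrite sumr_const card_Sn.
rewrite sum_permS; apply: eq_bigr => j _.
rewrite -IHn big_distrr; apply: eq_bigr => s _ /=.
rewrite mulrA -[in RHS]signr_odd -signr_addb odd_lift_perm enum_ordSl /= lift_perm_id.
by congr (_ * G (_ :: _)); rewrite -map_comp; apply: eq_map => i /=; rewrite lift_perm_lift.
Qed.

Section Kform.
Variables (R : realType) (V : vectType R).
Implicit Types (x y z : V).

Lemma altform_linear k (a : kform V k) (v : k.-tuple V) i : altform a ->
  forall c x y, a (tupd v i (c *: x + y)) = c * a (tupd v i x) + a (tupd v i y).
Proof. by case=> + _; apply. Qed.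

Lemma tupd_id k (v : k.-tuple V) i : tupd v i (tnth v i) = v.
Proof. by apply: eq_from_tnth => j; rewrite tnth_mktuple; case: eqP => // ->. Qed.

(** Polarization: [a] vanishes on the tuple that has the same sum in both slots i and j. *)
Lemma altform_swap k (a : kform V k) (v : k.-tuple V) (i j : 'I_k) : altform a -> i != j ->
  a [tuple tnth v (tperm i j l) | l < k] = - a v.
Proof.
move=> [lin alt] ij.
pose t x y := tupd (tupd v i x) j y.
have Di x x' y : a (t (x + x') y) = a (t x y) + a (t x' y).
  have tE u : t u y = tupd (tupd v j y) i u.
    apply: eq_from_tnth => l; rewrite !tnth_mktuple.
    by case: (eqVneq l j) => [->|//]; rewrite eq_sym (negPf ij).
  by rewrite !tE -[x in LHS]scale1r lin mul1r.
have Dj x y y' : a (t x (y + y')) = a (t x y) + a (t x y').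
  by rewrite /t -[y in LHS]scale1r lin mul1r.
have txx x : a (t x x) = 0.
  by apply: (alt _ i j ij); rewrite !tnth_mktuple !eqxx (negPf ij).
have tv : t (tnth v i) (tnth v j) = v by rewrite /t tupd_id tupd_id.
have := txx (tnth v i + tnth v j).
rewrite Di !Dj !txx add0r addr0 tv => /eqP; rewrite addrC addr_eq0 => /eqP <-.
congr (a _); apply: eq_from_tnth => l; rewrite !tnth_mktuple.
by case: tpermP => [->|->|/eqP/negPf-> /eqP/negPf->]; rewrite ?eqxx ?(negPf ij).
Qed.

(** Tracking only the vanishing avoids carrying the sign of s through its factorization into
    transpositions. *)
Lemma altform_perm_eq0 k (a : kform V k) (v : k.-tuple V) (s : 'S_k) : altform a ->
  a v = 0 -> a [tuple tnth v (s l) | l < k] = 0.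
Proof.
move=> alta; have [ts -> dts] := prod_tpermP s.
elim: ts dts v => [_|[i j] ts IHts /= /andP[ij dts]] v av0.
  rewrite big_nil -[RHS]av0; congr (a _).
  by apply: eq_from_tnth => l; rewrite tnth_mktuple perm1.
rewrite big_cons; set p := (\prod_(t <- ts) _)%g.
have -> : [tuple tnth v ((tperm i j * p)%g l) | l < k] =
    [tuple tnth [tuple tnth v (p m) | m < k] (tperm i j l) | l < k].
  by apply: eq_from_tnth => l; rewrite !tnth_mktuple permM.
by rewrite altform_swap // IHts ?oppr0.
Qed.

(** If [a] vanished on the basis, it would vanish on every tuple of basis vectors, hence everywhere
    by multilinearity. *)
Lemma altform_neq0 k (a : kform V k) (b : k.-tuple V) : altform a -> basis_of fullv b ->
  (exists v, a v != 0) -> a b != 0.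
Proof.
move=> alta bb [v]; apply: contra => /eqP ab0; apply/eqP.
have base (h : 'I_k -> 'I_k) : a [tuple tnth b (h l) | l < k] = 0.
  case: (boolP (injectiveb h)) => [/injectiveP inj_h|/injectivePn[i [j ij hij]]].
    rewrite -[RHS](altform_perm_eq0 (perm inj_h) alta ab0); congr (a _).
    by apply: eq_from_tnth => l; rewrite !tnth_mktuple permE.
  by apply: (alta.2 _ i j ij); rewrite !tnth_mktuple hij.
(* All slots from m on hold basis vectors; the induction on m frees one more slot at a time. *)
suff step m (w : k.-tuple V) : (forall i : 'I_k, (m <= i)%N -> tnth w i \in b) -> a w = 0.
  by apply: (step k) => i; rewrite leqNgt ltn_ord.
elim: m w => [|m IHm] w wb.
  have wbi i : exists l, tnth w i = tnth b l by apply/tnthP; apply: wb.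
  have [h hP] := choice wbi; rewrite -[RHS](base h); congr (a _).
  by apply: eq_from_tnth => l; rewrite tnth_mktuple hP.
case: (ltnP m k) => [mk|km]; last first.
  by apply: IHm => i mi; case: (leqP m.+1 i) => [/wb //|]; have := ltn_ord i; lia.
pose i0 := Ordinal mk; rewrite -(tupd_id w i0).
have wc := coord_basis bb (memvf (tnth w i0)).
have aw0 : a (tupd w i0 0) = 0.
  have := altform_linear w i0 alta (-1) 0 0.
  by rewrite scaler0 addr0 mulN1r addNr.
have linsum (c : 'I_k -> R) (r : seq 'I_k) : a (tupd w i0 (\sum_(l <- r) c l *: b`_l)) =
    \sum_(l <- r) c l * a (tupd w i0 b`_l).
  elim: r => [|l r IHr]; first by rewrite !big_nil.
  by rewrite !big_cons altform_linear // IHr.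
rewrite wc linsum big1 // => l _; rewrite IHm ?mulr0 // => i mi.
rewrite tnth_mktuple; case: eqP => [_|/eqP ii0]; first by rewrite mem_nth ?size_tuple.
by apply: wb; rewrite ltn_neqAle mi andbT eq_sym; apply: contra ii0 => /eqP iim; apply/eqP/val_inj.
Qed.

End Kform.

Lemma altsumS (K : pzRingType) (T : Type) n (v : 'I_n.+1 -> T) (G : seq T -> K) :
  altsum v G = \sum_(j < n.+1) (-1) ^+ j *
    altsum (fun i => v (lift j i)) (fun l => G (v j :: l)).
Proof. by []. Qed.

(** * Forms of degree 2 and 3 as functions of vectors *)

Section Alternating.
Variables (R : realType) (V : vectType R).

Record alt2 (f : V -> V -> R) : Prop := Alt2 {
  alt2P : forall c x y z, f (c *: x + y) z = c * f x z + f y z;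
  alt2C : forall x y, f y x = - f x y }.

Record alt3 (r : V -> V -> V -> R) : Prop := Alt3 {
  alt3P : forall c x y z t, r (c *: x + y) z t = c * r x z t + r y z t;
  alt3Cl : forall x y z, r y x z = - r x y z;
  alt3Cr : forall x y z, r x z y = - r x y z }.


Lemma altform2 (F : kform V 2) : altform F -> alt2 (fun x y => F [tuple x; y]).
Proof.
move=> altF; split=> [c x y z|x y].
  have := altform_linear [tuple x; z] ord0 altF c x y.
  suff tE u : tupd [tuple x; z] ord0 u = [tuple u; z] by rewrite !tE.
  by apply: eq_from_tnth => -[[|[|i]] //= lt_i]; rewrite tnth_mktuple.
rewrite -(altform_swap (i := ord0) (j := ord_max) [tuple x; y] altF) //; congr (F _).
by apply: eq_from_tnth => -[[|[|i]] //= lt_i]; rewrite tnth_mktuple permE.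
Qed.

Lemma altform3 (rho : kform V 3) : altform rho -> alt3 (fun x y z => rho [tuple x; y; z]).
Proof.
move=> altr; split=> [c x y z t|x y z|x y z].
- have := altform_linear [tuple x; z; t] ord0 altr c x y.
  suff tE u : tupd [tuple x; z; t] ord0 u = [tuple u; z; t] by rewrite !tE.
  by apply: eq_from_tnth => -[[|[|[|i]]] //= lt_i]; rewrite tnth_mktuple.
- rewrite -(altform_swap (i := ord0) (j := inord 1) [tuple x; y; z] altr); last first.
    by rewrite -val_eqE /= inordK.
  congr (rho _); apply: eq_from_tnth => -[[|[|[|i]]] //= lt_i]; rewrite tnth_mktuple permE /=.
  + by rewrite !(tnth_nth x) /= inordK.
  + by rewrite -val_eqE /= inordK.
  + by rewrite -val_eqE /= inordK.
- rewrite -(altform_swap (i := inord 1) (j := ord_max) [tuple x; y; z] altr); last first.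
    by rewrite -val_eqE /= inordK.
  congr (rho _); apply: eq_from_tnth => -[[|[|[|i]]] //= lt_i]; rewrite tnth_mktuple permE /=.
  + by rewrite -!val_eqE /= inordK.
  + by rewrite -!val_eqE /= inordK.
  + by rewrite -!val_eqE /= inordK //= !(tnth_nth x) /= inordK.
Qed.

(** The value of f /\ r on five vectors, summed over the ten (2,3)-shuffles. *)
Definition wedge23 (f : V -> V -> R) (r : V -> V -> V -> R) (v0 v1 v2 v3 v4 : V) : R :=
  f v0 v1 * r v2 v3 v4 - f v0 v2 * r v1 v3 v4 + f v0 v3 * r v1 v2 v4 - f v0 v4 * r v1 v2 v3 +
  f v1 v2 * r v0 v3 v4 - f v1 v3 * r v0 v2 v4 + f v1 v4 * r v0 v2 v3 +
  f v2 v3 * r v0 v1 v4 - f v2 v4 * r v0 v1 v3 + f v3 v4 * r v0 v1 v2.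

Lemma wedgef23 (F : kform V 2) (rho : kform V 3) v0 v1 v2 v3 v4 :
  alt2 (fun x y => F [tuple x; y]) -> alt3 (fun x y z => rho [tuple x; y; z]) ->
  wedgef F rho [tuple v0; v1; v2; v3; v4] =
  wedge23 (fun x y => F [tuple x; y]) (fun x y z => rho [tuple x; y; z]) v0 v1 v2 v3 v4.
Proof.
move=> [_ fC] [_ rCl rCr].
rewrite /wedgef.
pose t := [tuple v0; v1; v2; v3; v4].
pose f x y := F [tuple x; y]; pose r x y z := rho [tuple x; y; z].
pose G (l : seq V) := if l is [:: a; b; c; d; e] then f a b * r c d e else 0.
rewrite (eq_bigr (fun s : 'S_5 => (-1) ^+ s * G [seq tnth t (s i) | i <- enum 'I_5])); last first.
  move=> s _; rewrite -mulrA; congr (_ * _).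
  rewrite !enum_ordSl (_ : enum 'I_0 = [::]); last by apply: size0nil; rewrite size_enum_ord.
  rewrite /= /f /r; congr (F _ * rho _); apply: eq_from_tnth.
    case=> -[|[|i]] //= lt_i; rewrite tnth_mktuple !(tnth_nth v0) /=;
      by do 3 f_equal; apply: val_inj.
  case=> -[|[|[|i]]] //= lt_i; rewrite tnth_mktuple !(tnth_nth v0) /=;
    by do 3 f_equal; apply: val_inj.
rewrite altsumE.
(* For fixed first two arguments the six orders of the last three contribute equally. The order of
   the first two gives the other factor of 2! 3! = 12. *)
have alt3E (v : 'I_3 -> V) a b : altsum v (fun l => G (a :: b :: l)) =
    6%:R * (f a b * r (v ord0) (v (lift ord0 ord0)) (v (lift ord0 (lift ord0 ord0)))).
  have [x [y [z vE]]] : exists x y z, forall i, v i = nth 0 [:: x; y; z] i.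
    exists (v ord0), (v (lift ord0 ord0)), (v (lift ord0 (lift ord0 ord0))) => i.
    by case: i => -[|[|[|i]]] //= lt_i; congr v; apply: val_inj.
  rewrite /= !big_ord_recl !big_ord0 /= !vE.
  rewrite /bump /= !addn0 !add1n /=.
  have rl u1 u2 u3 : r u2 u1 u3 = - r u1 u2 u3 by apply: rCl.
  have rr u1 u2 u3 : r u1 u3 u2 = - r u1 u2 u3 by apply: rCr.
  by rewrite (rr x y z) (rl x y z) (rr y x z) (rl x y z) (rr z x y) (rl x z y) (rr x y z); ring.
rewrite (altsumS (n := 4)).
rewrite (eq_bigr (fun j : 'I_5 => (-1) ^+ j * \sum_(k < 4) (-1) ^+ k *
   (6%:R * (let v i := tnth t (lift j (lift k i)) in f (tnth t j) (tnth t (lift j k)) *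
     r (v ord0) (v (lift ord0 ord0)) (v (lift ord0 (lift ord0 ord0))))))); last first.
  by move=> j _; rewrite (altsumS (n := 3)); under eq_bigr do rewrite alt3E.
rewrite !big_ord_recl !big_ord0 /= !(tnth_nth 0) /bump /=.
rewrite !addn0 ![(1 + _)%N]/=.
have fN x y : f y x = - f x y by apply: fC.
rewrite (fN v0 v1) (fN v0 v2) (fN v0 v3) (fN v0 v4) (fN v1 v2) (fN v1 v3) (fN v1 v4).
rewrite (fN v2 v3) (fN v2 v4) (fN v3 v4) /wedge23 -!/(f _ _) -!/(r _ _ _).
by have -> : (2`! * 3`!)%N = 12 by []; field.
Qed.

End Alternating.

(** * The endomorphism attached to rho *)

Section Su3Endomorphism.
Import VectorInternalTheory.
Variables (R : realType) (V : vectType R).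
Lemma linfun_r2v (W : vectType R) (h : V -> W) i :
  linfun h (r2v (delta_mx 0 i)) = h (r2v (delta_mx 0 i)).
Proof.
rewrite 2!unlock /= r2vK -rowE; apply: v2r_inj; rewrite r2vK.
by apply/rowP => j; rewrite !mxE.
Qed.

Lemma alt2Pr (f : V -> V -> R) : alt2 f -> forall c x y z, f z (c *: x + y) = c * f z x + f z y.
Proof. by case=> fP fC c x y z; rewrite fC fP !(fC _ z); ring. Qed.

Lemma alt3_intprod (r : V -> V -> V -> R) x : alt3 r -> alt2 (r x).
Proof.
case=> rP rl rr; split=> [c y z t|y z]; last exact: rr.
by rewrite (rl _ x) rP (rl x y) (rl x z); ring.
Qed.

(** These two properties are all that is later used of [Krho] and of the metric. Both sides of the
    first one are linear in x, so it is enough to verify it on the coordinate basis. *)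
Lemma su3_endo (vol : kform V 6) (F : kform V 2) (rho : kform V 3) :
  volume_form vol -> su3_structure vol F rho ->
  exists K : 'End(V),
    (forall x v0 v1 v2 v3 v4, vol [tuple K x; v0; v1; v2; v3; v4] =
       wedge23 (fun y z => rho [tuple x; y; z]) (fun y z t => rho [tuple y; z; t]) v0 v1 v2 v3 v4)
    /\ (forall x, x != 0 -> 0 < F [tuple K x; x]).
Proof.
move=> [altv _] [altF altr _ _ _ _ _ pos].
have [fP _] := altform2 altF; have r3 := altform3 altr; have [rP _ _] := r3.
(* [Jrho] is [Krho] times a scalar s >= 0, and s = 0 would contradict positivity of the metric. *)
have KF x : x != 0 -> 0 < F [tuple Krho vol rho x; x].
  move=> /pos; rewrite /su3_metric /Jrho scale_lfunE.
  set s := (Num.sqrt _)^-1; set y := Krho _ _ _.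
  have := fP s y 0 x; have := fP 1 0 0 x; rewrite scaler0 addr0 mul1r => f0.
  rewrite addr0 => ->; have -> : F [tuple 0; x] = 0 by lra.
  rewrite addr0; have : 0 <= s by rewrite invr_ge0 sqrtr_ge0.
  by rewrite le_eqVlt => /orP[/eqP <-|s0]; rewrite ?mul0r ?ltxx // pmulr_rgt0.
have Kb i (b := r2v (delta_mx 0 i) : V) :
    intprod (Krho vol rho b) vol =1 wedgef (intprod b rho) rho.
  have b0 : b != 0.
    apply/eqP => /(congr1 v2r); rewrite r2vK linear0 => /matrixP/(_ 0 i)/eqP.
    by rewrite !mxE !eqxx oner_eq0.
  (* [kappa] returns 0 when no vector represents the 5-form; positivity of the *)
  (* metric at [b] excludes this case. *)
  have := KF _ b0; rewrite /Krho linfun_r2v /kappa.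
  case: xgetP => [y -> //|_].
  by have := fP (-1) 0 0 b; rewrite scaler0 addr0 mulN1r addNr => ->; rewrite ltxx.
exists (Krho vol rho); split=> // x v0 v1 v2 v3 v4.
pose W y := wedge23 (fun z t => rho [tuple y; z; t]) (fun z t u => rho [tuple z; t; u])
  v0 v1 v2 v3 v4.
pose v y := vol [tuple y; v0; v1; v2; v3; v4].
have WP c y z : W (c *: y + z) = c * W y + W z by rewrite /W /wedge23 !rP; ring.
have vP c y z : v (c *: y + z) = c * v y + v z.
  have := altform_linear [tuple 0; v0; v1; v2; v3; v4] ord0 altv c y z.
  suff tE u : tupd [tuple 0; v0; v1; v2; v3; v4] ord0 u = [tuple u; v0; v1; v2; v3; v4].
    by rewrite !tE.
  apply: eq_from_tnth => i; rewrite tnth_mktuple; case: (unliftP ord0 i) => [j|] -> //.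
  by rewrite !(tnth_nth 0).
rewrite -[LHS]/(v _) -[RHS]/(W _).
have W0 : W 0 = 0 by have := WP (-1) 0 0; rewrite scaler0 addr0 mulN1r addNr.
have v00 : v 0 = 0 by have := vP (-1) 0 0; rewrite scaler0 addr0 mulN1r addNr.
rewrite -(v2rK x) [v2r x]row_sum_delta linear_sum.
elim/big_rec: _ => [|i y _ IHy]; first by rewrite linear0 v00 W0.
rewrite linearZ linearP vP WP IHy; congr (_ * _ + _).
have := Kb i [tuple v0; v1; v2; v3; v4].
rewrite wedgef23; last exact: r3; last exact: alt3_intprod r3.
by move=> E; exact: E.
Qed.

End Su3Endomorphism.

(** * Linear forms, brackets and the data of a half-flat structure *)

Definition linform (R : realType) (V : vectType R) (phi : V -> R) : Prop :=
  forall c x y, phi (c *: x + y) = c * phi x + phi y.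

Section LinForm.
Variables (R : realType) (V : vectType R) (phi : V -> R).
Hypothesis phiP : linform phi.

(** Seen as a map into the one-dimensional space [R^o], phi loses at most one dimension on any U by
    rank-nullity. *)
Lemma linform_ker : exists K : {vspace V},
  (forall x, (x \in K) = (phi x == 0)) /\ forall U, (\dim U <= (\dim (U :&: K)).+1)%N.
Proof.
pose phi' : V -> R^o := phi.
have phi'P : linear phi' by [].
pose phiL := GRing.isLinear.Build R V R^o *:%R phi' phi'P.
pose ph : {linear V -> R^o} := HB.pack phi' phiL.
exists (lker (linfun ph)); split=> [x|U]; first by rewrite memv_ker lfunE.
rewrite -(limg_ker_dim (linfun ph) U) -addn1 leq_add2l.
by apply: leq_trans (dimvS (subvf _)) _; rewrite dimvf.
Qed.

Lemma span_linear0 s x : x \in <<s>>%VS -> all (fun y => phi y == 0) s -> phi x = 0.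
Proof.
have [K [KP _]] := linform_ker => sx /allP s0; apply/eqP; rewrite -KP.
by apply: subvP sx; apply/span_subvP => y /s0; rewrite KP.
Qed.

End LinForm.

Section Su3.
Variables (R : realType) (V : vectType R).
(** The Pfaffian of the Gram matrix of w, that is, half of w /\ w. On independent vectors it is
    nonzero exactly when w is nondegenerate on their span. *)
Definition pfaff (w : V -> V -> R) (x y z t : V) : R :=
  w x y * w z t - w x z * w y t + w x t * w y z.

(** Since F(K x, x) > 0, the vector K x completes x, y, z, t, u to a basis. There [vol] is nonzero,
    and it equals twice the Pfaffian because the terms with a repeated x vanish. *)
Lemma su3_pfaff (vol : kform V 6) (F : kform V 2) (rho : kform V 3) x y z t u :
  \dim {:V} = 6 -> volume_form vol -> su3_structure vol F rho ->
  free [:: x; y; z; t; u] ->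
  F [tuple x; y] = 0 -> F [tuple x; z] = 0 -> F [tuple x; t] = 0 -> F [tuple x; u] = 0 ->
  pfaff (fun v w => rho [tuple x; v; w]) y z t u != 0.
Proof.
move=> dimV volP su3 fr fy fz ft fu.
have [K [volK posK]] := su3_endo volP su3.
have [altF altr _ _ _ _ _ _] := su3.
have f2 := altform2 altF; have [fP fC] := f2; have [rP rl rr] := altform3 altr.
have fx : F [tuple x; x] = 0 by have := fC x x; lra.
have x0 : x != 0.
  by move: fr; rewrite free_cons => /andP[+ _]; apply: contraNN => /eqP->; rewrite mem0v.
have frK : free [:: K x; x; y; z; t; u].
  rewrite free_cons fr andbT; apply/negP => Kx.
  have := posK _ x0; suff -> : F [tuple K x; x] = 0 by rewrite ltxx.
  rewrite fC (span_linear0 (phi := fun v => F [tuple x; v]) _ Kx) ?oppr0 //=.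
    by move=> c v w; apply: (alt2Pr f2).
  by rewrite fx fy fz ft fu eqxx.
have := altform_neq0 (b := [tuple K x; x; y; z; t; u]) volP.1 _ volP.2.
rewrite volK basisEfree frK subvf dimV /= => /(_ isT); apply: contraNN => /eqP.
have rll a b : rho [tuple a; a; b] = 0 by have := rl a a b; lra.
have rlr a b : rho [tuple a; b; a] = 0 by rewrite rr rll oppr0.
rewrite /pfaff /wedge23 !rll !mul0r => pf0; apply/eqP.
by lra.
Qed.

End Su3.

Section Lie.
Variables (R : realType) (g : lieAlgType R).
Implicit Types x y z : g.

Lemma liePr c x y z : lie z (c *: x + y) = c *: lie z x + lie z y.
Proof. exact: lie_linearr. Qed.

Lemma liePl c x y z : lie (c *: x + y) z = c *: lie x z + lie y z.
Proof. exact: lie_linearl. Qed.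

Lemma lieDr x y z : lie z (x + y) = lie z x + lie z y.
Proof. by rewrite -[x in LHS]scale1r liePr scale1r. Qed.

Lemma lieDl x y z : lie (x + y) z = lie x z + lie y z.
Proof. by rewrite -[x in LHS]scale1r liePl scale1r. Qed.

Lemma lieZr c x y : lie x (c *: y) = c *: lie x y.
Proof. exact: linearZ. Qed.

Lemma lieZl c x y : lie (c *: x) y = c *: lie x y.
Proof. by rewrite -[LHS]/(lier y (c *: x)) linearZ. Qed.

Lemma lieC x y : lie y x = - lie x y.
Proof.
have := liexx (x + y); rewrite lieDr !lieDl !liexx add0r addr0 => /eqP.
by rewrite addr_eq0 => /eqP.
Qed.

End Lie.


(** [CEd] expands to minus this cyclic sum; the opposite sign of the [x,z] term is absorbed by
    writing [z,x]. *)
Lemma CEclosed2 (R : realType) (g : lieAlgType R) (F : kform g 2) : CEclosed F ->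
  alt2 (fun x y => F [tuple x; y]) ->
  forall x y z, F [tuple lie x y; z] + F [tuple lie y z; x] + F [tuple lie z x; y] = 0.
Proof.
move=> dF [fP fC] x y z; have := dF [tuple x; y; z].
pose Fs (l : seq g) := F [tuple nth 0 l 0; nth 0 l 1].
have FsE (t : 2.-tuple g) : F t = Fs t.
  by rewrite /Fs; congr (F _); apply: eq_from_tnth => -[[|[|i]] //= lt_i]; rewrite !(tnth_nth 0).
rewrite /CEd; under eq_bigr do rewrite big_mkcond.
rewrite !big_ord_recl !big_ord0 /= !FsE /= !enum_ordSl /= !(tnth_nth 0) /bump /= /Fs /=.
rewrite (lieC x z) -scaleN1r -[_ *: _]addr0 fP.
have -> : F [tuple 0; y] = 0 by have := fP (-1) 0 0 y; rewrite scaler0 addr0 mulN1r addNr.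
by move=> E; lra.
Qed.

Lemma CEclosed3 (R : realType) (g : lieAlgType R) (rho : kform g 3) : CEclosed rho ->
  forall x y z t, rho [tuple lie x y; z; t] - rho [tuple lie x z; y; t] +
    rho [tuple lie x t; y; z] + rho [tuple lie y z; x; t] - rho [tuple lie y t; x; z] +
    rho [tuple lie z t; x; y] = 0.
Proof.
move=> dr x y z t; have := dr [tuple x; y; z; t].
pose rs (l : seq g) := rho [tuple nth 0 l 0; nth 0 l 1; nth 0 l 2].
have rsE (v : 3.-tuple g) : rho v = rs v.
  rewrite /rs; congr (rho _); apply: eq_from_tnth => -[[|[|[|i]]] //= lt_i];
    by rewrite !(tnth_nth 0).
rewrite /CEd; under eq_bigr do rewrite big_mkcond.
rewrite !big_ord_recl !big_ord0 /= !rsE /= !enum_ordSl /= !(tnth_nth 0) /bump /= /rs /=.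
by rewrite !addn0 ![(1 + _)%N]/= => E; lra.
Qed.

(** The input of the Lie-theoretic part, with [vol] and [Krho] eliminated. In [shf_pfaff] the five
    vectors span the hyperplane ker f(x, .), so r(x, ., .) is nondegenerate there modulo x. *)
Record shf_data (R : realType) (g : lieAlgType R)
    (f : g -> g -> R) (r : g -> g -> g -> R) : Prop := ShfData {
  shf_f : alt2 f;
  shf_r : alt3 r;
  shf_neq0 : forall x, x != 0 -> exists y, f x y != 0;
  shf_pfaff : forall x y z t u, free [:: x; y; z; t; u] ->
    f x y = 0 -> f x z = 0 -> f x t = 0 -> f x u = 0 -> pfaff (r x) y z t u != 0;
  shf_wedge : forall x y z t u, wedge23 f r x y z t u = 0;
  shf_df : forall x y z, f (lie x y) z + f (lie y z) x + f (lie z x) y = 0;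
  shf_dr : forall x y z t, r (lie x y) z t - r (lie x z) y t + r (lie x t) y z
    + r (lie y z) x t - r (lie y t) x z + r (lie z t) x y = 0 }.

Lemma symplectic_half_flat_data (R : realType) (g : lieAlgType R)
    (vol : kform g 6) (F : kform g 2) (rho : kform g 3) :
  \dim {:g} = 6 -> volume_form vol -> symplectic_half_flat vol F rho ->
  shf_data (fun x y => F [tuple x; y]) (fun x y z => rho [tuple x; y; z]).
Proof.
move=> dimg volP [su3 dF dr]; have [altF altr _ _ _ Frho _ _] := su3.
have f2 := altform2 altF; have r3 := altform3 altr.
split=> // [x x0|x y z t u|x y z t u||].
- have [K [_ posK]] := su3_endo volP su3; exists (K x).
  by have [_ fC] := f2; rewrite (fC (K x)) oppr_eq0 gt_eqF ?posK.
- by move=> *; apply: (su3_pfaff dimg volP su3).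
- by rewrite -wedgef23.
- exact: CEclosed2.
- exact: CEclosed3.
Qed.

(** * Hyperkaehler triples on four-dimensional Lie algebras *)

(* With cabd the coefficient of h_d in [h_a, h_b], the left-hand side is *)
(* J_123^0 - J_023^1 + J_013^2 - J_012^3, where J_abc^d is the coefficient of h_d *)
(* in the Jacobi identity for h_a, h_b, h_c. *)
Lemma hyperkaehler_sos (R : realType)
    (c010 c011 c012 c013 c020 c021 c022 c023 c030 c031 c032 c033 : R) :
  6 * c010 * c010 - 4 * c010 * c023 + 4 * c010 * c032 + 2 * c011 * c011
  + 2 * c012 * c012 - 4 * c012 * c030 + 2 * c013 * c013 + 4 * c013 * c020
  + 6 * c020 * c020 - 4 * c020 * c031 + 2 * c021 * c021 + 4 * c021 * c030
  + 2 * c022 * c022 + 2 * c023 * c023 + 6 * c030 * c030 + 2 * c031 * c031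
  + 2 * c032 * c032 + 2 * c033 * c033 = 0 ->
  [/\ [/\ c010 = 0, c011 = 0, c012 = 0 & c013 = 0],
      [/\ c020 = 0, c021 = 0, c022 = 0 & c023 = 0]
    & [/\ c030 = 0, c031 = 0, c032 = 0 & c033 = 0]].
Proof.
move=> S0.
(* Apart from the squares of c011, c022 and c033, the quadratic form splits into three blocks of
   this shape. *)
have sq (a b c : R) : 0 <= 2 * a * a + 2 * (a - b) * (a - b) + 2 * (a + c) * (a + c).
  by have := sqr_ge0 a; have := sqr_ge0 (a - b); have := sqr_ge0 (a + c); nra.
have sq0 (a b c : R) :
    2 * a * a + 2 * (a - b) * (a - b) + 2 * (a + c) * (a + c) <= 0 ->
    [/\ a = 0, b = 0 & c = 0].
  move=> le0; have := sqr_ge0 a; have := sqr_ge0 (a - b); have := sqr_ge0 (a + c).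
  rewrite !expr2 => c2 b2 a2.
  have a0 : a = 0 by apply/eqP; rewrite -sqrf_eq0 eq_le sqr_ge0 andbT expr2; lra.
  rewrite a0 in le0 c2 b2.
  by split=> //; apply/eqP; rewrite -sqrf_eq0 eq_le sqr_ge0 andbT expr2; lra.
have z0 (a : R) : 2 * a * a <= 0 -> a = 0.
  by move=> ?; apply/eqP; rewrite -sqrf_eq0 eq_le sqr_ge0 andbT; nra.
have s1 := sq c010 c023 c032; have s2 := sq c020 c031 c013; have s3 := sq c030 c012 c021.
have d1 := sqr_ge0 c011; have d2 := sqr_ge0 c022; have d3 := sqr_ge0 c033.
have [|-> -> ->] := sq0 c010 c023 c032; first by lra.
have [|-> -> ->] := sq0 c020 c031 c013; first by lra.
have [|-> -> ->] := sq0 c030 c012 c021; first by lra.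
by do !split=> //; apply: z0; lra.
Qed.

(* In the application [h0,h1] = a h1 + b h2 + d h3, [h0,h2] = b h1 + e h2 + f h3 *)
(* and [h0,h3] = d h1 + (f + t) h2 + g h3. The six linear equations say that a *)
(* multiple of w3 is exact, and the last two are J_013^2 and J_023^1. *)
Lemma frobenius_contradiction (R : realType) (a b d e f g t g1 g2 g3 s : R) :
  s != 0 ->
  a * g1 + b * g2 + d * g3 = 0 ->
  b * g1 + e * g2 + f * g3 = 0 ->
  d * g1 + (f + t) * g2 + g * g3 = s ->
  - d * g1 - (f + t) * g2 + (a + e) * g3 = s ->
  b * g1 - (a + g) * g2 + (f + t) * g3 = 0 ->
  (e + g) * g1 - b * g2 - d * g3 = 0 ->
  (a + g) * (a + g) - e * (a + g) + 2 * b * b + 2 * (f + t) * (f + t) = 0 ->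
  a * (e + g) - (e + g) * (e + g) - 2 * b * b - 2 * d * d = 0 -> False.
Proof.
move=> s0 E1 E2 E3 E4 E5 E6 J1 J2.
(* T is the trace of ad h0 in the application. E3 + E4, E1 + E6 and E2 - E5 give T g3 = 2 s, T g1 =
   0 and T g2 = t g3, so that g1, g2, g3 can be eliminated. *)
set T := a + e + g.
have Tg3 : T * g3 = 2 * s by rewrite /T; lra.
have T0 : T != 0.
  by apply: contraNneq s0 => T0; move: Tg3; rewrite T0 mul0r => ?; apply/eqP; lra.
have g30 : g3 != 0.
  by apply: contraNneq s0 => g30; move: Tg3; rewrite g30 mulr0 => ?; apply/eqP; lra.
have g10 : g1 = 0 by apply: (mulfI T0); rewrite /T; lra.
have Tg2 : T * g2 = t * g3 by rewrite /T; lra.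
have ET (x y : R) : x * g2 + y * g3 = 0 -> y * T = - (x * t).
  move=> E; apply: (mulIf g30); have := congr1 ( *%R T) E; have := congr1 ( *%R x) Tg2.
  by move=> *; lra.
have Td := ET b d; have Tf := ET e f; rewrite g10 !mulr0 !add0r in E1 E2 E3.
move/Td: E1 => {}Td; move/Tf: E2 => {}Tf.
have Tg : (f + t) * t + g * T = T * T / 2.
  apply: (mulIf g30); have := congr1 ( *%R T) E3; have := congr1 ( *%R (f + t)) Tg2.
  by have := congr1 ( *%R T) Tg3; move=> *; lra.
(* With U = T^3 and B = 2 b^2 T^2 n >= 0, J1 becomes 2 y^2 - y U + B = 0 and J2 becomes (3U/2 -
   y)(2y - 2U) = B. Eliminating B gives y = 3U/4, and then J1 reads 3U^2/8 + B = 0. *)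
pose q := a + g; pose n := T * T + t * t; pose y := q * n.
have fT : (f + t) * T = t * q by rewrite /q; move: Tf; rewrite /T => Tf; lra.
have eE : e = T - q by rewrite /T /q; ring.
have aE : a = q - g by rewrite /q; ring.
have gT : g * T * T = T * T * T / 2 - t * t * q.
  have := congr1 ( *%R T) Tg; have := congr1 ( *%R t) fT; move=> *; lra.
have A : 2 * q * q * n - q * (T * T * T) + 2 * b * b * (T * T) = 0.
  have -> : 2 * q * q * n - q * (T * T * T) + 2 * b * b * (T * T) =
    T * T * (q * q - (T - q) * q + 2 * b * b + 2 * (f + t) * (f + t)) +
    2 * (t * q * (t * q) - (f + t) * T * ((f + t) * T)) by rewrite /n; ring.
  by rewrite fT subrr mulr0 addr0 -eE J1 mulr0.
have aT : a * (T * T) = y - T * T * T / 2 by rewrite aE /y /n; lra.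
have C : (3 * (T * T * T) / 2 - y) * (2 * y - 2 * (T * T * T)) = 2 * b * b * (T * T) * n.
  have -> : 3 * (T * T * T) / 2 - y = (T - a) * (T * T) by lra.
  have -> : 2 * y - 2 * (T * T * T) = (2 * a - T) * (T * T) by lra.
  have -> : 2 * b * b * (T * T) * n =
    T * T * (T * T * (2 * b * b) + 2 * (b * t) * (b * t)) by rewrite /n; ring.
  have -> : 2 * (b * t) * (b * t) = 2 * (d * T) * (d * T) by rewrite Td; ring.
  have := congr1 ( *%R (T * T * T * T)) J2.
  have -> : e + g = T - a by rewrite /T; ring.
  by move=> *; lra.
have n0 : 0 < n by rewrite /n; nra.
have B0 : 0 <= 2 * b * b * (T * T) * n.
  by rewrite mulr_ge0 ?(ltW n0) //; have := sqr_ge0 (b * T); rewrite expr2; lra.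
pose U := T * T * T; have U0 : U != 0 by rewrite !mulf_neq0.
have yB : 2 * y * y - y * U + 2 * b * b * (T * T) * n = 0.
  by rewrite -[RHS](mulr0 n) -A /y /U; ring.
have yU : y = 3 / 4 * U.
  apply: (mulIf U0); move: C; rewrite -/U => C; lra.
have : 0 < U * U by rewrite -expr2 exprn_even_gt0.
by move: yB; rewrite yU => yB; lra.
Qed.

(** * Structure constants in an adapted frame *)

Section Frame.
Variables (R : realType) (g : lieAlgType R).

(* w = N x^* /\ y^* + M z^* /\ t^* in the basis dual to x, y, z, t. *)
Definition std_pairing (w : g -> g -> R) (N M : R) (x y z t : g) : Prop :=
  [/\ w x y = N, w x z = 0 & w x t = 0] /\ [/\ w z t = M, w t y = 0 & w y z = 0].

Lemma linform_alt2 (w : g -> g -> R) : alt2 w ->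
  (forall x, linform (w x)) /\ (forall y, linform (w ^~ y)).
Proof. by move=> w2; split=> [x c y z|y c x z]; [apply: (alt2Pr w2)|case: w2 => ->]. Qed.

Lemma alt2xx (w : g -> g -> R) x : alt2 w -> w x x = 0.
Proof. by case=> _ wC; have := wC x x; lra. Qed.

Lemma span_consP (x y : g) s : y \in <<x :: s>>%VS ->
  exists c, exists2 z, z \in <<s>>%VS & y = c *: x + z.
Proof. by rewrite span_cons => /memv_addP[_ /vlineP[c ->] [v vs ->]]; exists c, v. Qed.

Lemma linform0 (phi : g -> R) : linform phi -> phi 0 = 0.
Proof. by move=> lin; have := lin (-1) 0 0; rewrite scaler0 addr0 mulN1r addNr. Qed.

(* With all N_i = 1, w_i = h_0^* /\ h_i^* + h_j^* /\ h_k^* for (i j k) cyclic. *)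
Record frame (H : {vspace g}) (w1 w2 w3 : g -> g -> R) (N1 N2 N3 : R) (h0 h1 h2 h3 : g) :
    Prop := Frame {
  frame_alt : [/\ alt2 w1, alt2 w2 & alt2 w3];
  frame_neq0 : [/\ N1 != 0, N2 != 0 & N3 != 0];
  frame_std : [/\ std_pairing w1 N1 N1 h0 h1 h2 h3, std_pairing w2 N2 N2 h0 h2 h3 h1
                & std_pairing w3 N3 N3 h0 h3 h1 h2];
  frame_mem : [/\ h0 \in H, h1 \in H, h2 \in H & h3 \in H];
  frame_dim : (\dim H <= 4)%N }.

(** A tuple of all sixteen values, so that one [rewrite] evaluates w on any two of the four
    vectors. *)
Lemma std_pairing_table (w : g -> g -> R) N M x y z t : alt2 w -> std_pairing w N M x y z t ->
  (w x x = 0) * (w y y = 0) * (w z z = 0) * (w t t = 0) *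
  (w x y = N) * (w x z = 0) * (w x t = 0) * (w z t = M) * (w t y = 0) * (w y z = 0) *
  (w y x = - N) * (w z x = 0) * (w t x = 0) * (w t z = - M) * (w y t = 0) * (w z y = 0).
Proof.
move=> aw [[wxy wxz wxt] [wzt wty wyz]]; have [_ C] := aw.
rewrite !alt2xx // (C x y) (C x z) (C x t) (C z t) (C t y) (C y z).
by rewrite wxy wxz wxt wzt wty wyz !oppr0.
Qed.

Section Coordinates.
Variables (H : {vspace g}) (w1 w2 w3 : g -> g -> R) (N1 N2 N3 : R) (h0 h1 h2 h3 : g).
Hypothesis fr : frame H w1 w2 w3 N1 N2 N3 h0 h1 h2 h3.

Lemma frame_span : (H <= <<[:: h0; h1; h2; h3]>>)%VS.
Proof.
have [[a1 a2 a3] [N10 N20 N30] [s1 s2 s3] [H0 H1 H2 H3] dimH] := fr.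
have T1 := std_pairing_table a1 s1; have T2 := std_pairing_table a2 s2.
have T3 := std_pairing_table a3 s3.
have notin (phi : g -> R) x s : linform phi -> all (fun y => phi y == 0) s -> phi x != 0 ->
    x \notin <<s>>%VS.
  by move=> lin s0; apply: contra => /(span_linear0 lin)->.
have fh : free [:: h0; h1; h2; h3].
  rewrite !free_cons !nil_free !andbT; apply/and4P; split.
  - by apply: (notin (w1 ^~ h1)); rewrite /= ?T1 ?eqxx //; apply: (linform_alt2 a1).2.
  - by apply: (notin (w1 h0)); rewrite /= ?T1 ?eqxx //; apply: (linform_alt2 a1).1.
  - by apply: (notin (w2 h0)); rewrite /= ?T2 ?eqxx //; apply: (linform_alt2 a2).1.
  - by apply: (notin (w3 h0)); rewrite /= ?T3 ?eqxx //; apply: (linform_alt2 a3).1.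
have sub : (<<[:: h0; h1; h2; h3]>> <= H)%VS.
  by apply/span_subvP => y; rewrite !inE => /or4P[] /eqP->.
by rewrite -(geq_leqif (dimv_leqif_sup sub)) (eqP fh).
Qed.

(** The coordinates are pairings: on the frame w1(., h1) detects only h0, and w_i(h0, .) detects
    only h_i. *)
Lemma frame_coord : exists p0 p1 p2 p3 : g -> R,
  [/\ forall y, y \in H -> p0 y = 0 -> p1 y = 0 -> p2 y = 0 -> p3 y = 0 -> y = 0,
       [/\ linform p0, linform p1, linform p2 & linform p3]
     & forall phi y, linform phi -> y \in H ->
         phi y = p0 y * phi h0 + p1 y * phi h1 + p2 y * phi h2 + p3 y * phi h3].
Proof.
have [[a1 a2 a3] [N10 N20 N30] [s1 s2 s3] _ _] := fr; have sp := frame_span.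
have T1 := std_pairing_table a1 s1; have T2 := std_pairing_table a2 s2.
have T3 := std_pairing_table a3 s3.
have [P1 C1] := a1; have L1 := alt2Pr a1; have L2 := alt2Pr a2; have L3 := alt2Pr a3.
pose p0 y := w1 y h1 / N1; pose p1 y := w1 h0 y / N1.
pose p2 y := w2 h0 y / N2; pose p3 y := w3 h0 y / N3.
have yE y : y \in H -> y = p0 y *: h0 + (p1 y *: h1 + (p2 y *: h2 + (p3 y *: h3 + 0))).
  move=> /(subvP sp) /span_consP[c0 [y0 /span_consP[c1 [y1 /span_consP[c2 [y2]]]]]].
  move=> /span_consP[c3 [y3]]; rewrite span_nil memv0 => /eqP -> -> -> -> ->.
  have [w10 w20 w30] : [/\ forall x, w1 x 0 = 0, forall x, w2 x 0 = 0 & forall x, w3 x 0 = 0].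
    by split=> x; apply: (@linform0 (_ x)) => c u v; rewrite ?L1 ?L2 ?L3.
  have w10' x : w1 0 x = 0 by rewrite C1 w10 oppr0.
  rewrite /p0 /p1 /p2 /p3 !(L1, L2, L3, P1) !(w10, w20, w30, w10') !(T1, T2, T3).
  by rewrite !(mulr0, addr0, add0r) !mulfK.
exists p0, p1, p2, p3; split=> [y yH e0 e1 e2 e3||phi y lin /yE yE'].
- by rewrite (yE y yH) e0 e1 e2 e3 !scale0r !addr0.
- by split=> c u v; rewrite /p0 /p1 /p2 /p3 ?P1 ?L1 ?L2 ?L3; ring.
- by rewrite {1}yE' !lin (linform0 lin); ring.
Qed.

Hypothesis Hlie : forall x y, x \in H -> y \in H -> lie x y \in H.
Variable k : g -> R.
Hypothesis d1 : forall x y z, x \in H -> y \in H -> z \in H ->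
  w1 (lie x y) z + w1 (lie y z) x + w1 (lie z x) y = 0.
Hypothesis d2 : forall x y z, x \in H -> y \in H -> z \in H ->
  w2 (lie x y) z + w2 (lie y z) x + w2 (lie z x) y =
  k x * w3 y z + k y * w3 z x + k z * w3 x y.
Hypothesis d3 : forall x y z, x \in H -> y \in H -> z \in H ->
  w3 (lie x y) z + w3 (lie y z) x + w3 (lie z x) y = 0.

(* The twelve equations solve d w1 = d w3 = 0, d w2 = k /\ w3 for the brackets *)
(* [h_i, h_j], i, j > 0, in terms of the coefficients of the [h_0, h_i]. *)
Lemma frame_structure : exists p0 p1 p2 p3 : g -> R,
  [/\ forall y, y \in H -> p0 y = 0 -> p1 y = 0 -> p2 y = 0 -> p3 y = 0 -> y = 0,
       [/\ linform p0, linform p1, linform p2 & linform p3],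
     forall phi y, linform phi -> y \in H ->
         phi y = p0 y * phi h0 + p1 y * phi h1 + p2 y * phi h2 + p3 y * phi h3
  & [/\ [/\ p0 (lie h1 h2) = p2 (lie h0 h1) - p1 (lie h0 h2) - 2 * p0 (lie h0 h3) + N3 / N2 * k h2,
       p1 (lie h1 h2) = - p3 (lie h0 h1) - p0 (lie h0 h2),
       p2 (lie h1 h2) = p0 (lie h0 h1) - p3 (lie h0 h2) - N3 / N2 * k h0
     & p3 (lie h1 h2) = p1 (lie h0 h1) + p2 (lie h0 h2)],
    [/\ p0 (lie h1 h3) = p3 (lie h0 h1) + 2 * p0 (lie h0 h2) - p1 (lie h0 h3) - N3 / N2 * k h3,
       p1 (lie h1 h3) = p2 (lie h0 h1) - p0 (lie h0 h3),
       p2 (lie h1 h3) = - p1 (lie h0 h1) - p3 (lie h0 h3) + N3 / N2 * k h1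
     & p3 (lie h1 h3) = p0 (lie h0 h1) + p2 (lie h0 h3)]
  & [/\ p0 (lie h2 h3) = - 2 * p0 (lie h0 h1) + p3 (lie h0 h2) - p2 (lie h0 h3) + N3 / N2 * k h0,
       p1 (lie h2 h3) = p2 (lie h0 h2) + p3 (lie h0 h3),
       p2 (lie h2 h3) = - p1 (lie h0 h2) - p0 (lie h0 h3) + N3 / N2 * k h2
     & p3 (lie h2 h3) = p0 (lie h0 h2) - p1 (lie h0 h3)]]].
Proof.
have [[a1 a2 a3] [N10 N20 N30] [s1 s2 s3] [H0 H1 H2 H3] _] := fr.
have T1 := std_pairing_table a1 s1; have T2 := std_pairing_table a2 s2.
have T3 := std_pairing_table a3 s3.
have [p0 [p1 [p2 [p3 [pinj [L0 L1 L2 L3] pE]]]]] := frame_coord.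
have lE (w : g -> g -> R) x y z : alt2 w -> x \in H -> y \in H ->
    w (lie x y) z = p0 (lie x y) * w h0 z + p1 (lie x y) * w h1 z + p2 (lie x y) * w h2 z
    + p3 (lie x y) * w h3 z.
  by move=> [P _] xH yH; apply: (pE (w ^~ z)) (Hlie xH yH) => c u v; apply: P.
have pN (p : g -> R) x y : linform p -> p (lie y x) = - p (lie x y).
  by move=> lin; rewrite lieC -scaleN1r -[_ *: _]addr0 lin linform0 //; ring.
have NK y : N2 * (N3 / N2 * y) = N3 * y by rewrite mulrA mulrCA divff // mulr1.
exists p0, p1, p2, p3; split=> //.
have NK0 := NK (k h0); have NK1 := NK (k h1); have NK2 := NK (k h2); have NK3 := NK (k h3).
(* The hypothesis named e, i, a, b, c is the equation for d w_i on h_a, h_b, h_c, divided by N_i.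
   Those for w2 carry the term k /\ w3, scaled by N3 / N2. *)
have e1012 : - p3 (lie h0 h1) - p0 (lie h0 h2) - p1 (lie h1 h2) = 0.
  have := d1 H0 H1 H2; rewrite !(lE w1) // !(pN _ h0 h2) // !(T1, T2, T3) => e.
  by apply: (mulfI N10); lra.
have e1013 : p2 (lie h0 h1) - p0 (lie h0 h3) - p1 (lie h1 h3) = 0.
  have := d1 H0 H1 H3; rewrite !(lE w1) // !(pN _ h0 h3) // !(T1, T2, T3) => e.
  by apply: (mulfI N10); lra.
have e1023 : p2 (lie h0 h2) + p3 (lie h0 h3) - p1 (lie h2 h3) = 0.
  have := d1 H0 H2 H3; rewrite !(lE w1) // !(pN _ h0 h3) // !(T1, T2, T3) => e.
  by apply: (mulfI N10); lra.
have e1123 : p2 (lie h1 h2) + p3 (lie h1 h3) + p0 (lie h2 h3) = 0.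
  have := d1 H1 H2 H3; rewrite !(lE w1) // !(pN _ h1 h3) // !(T1, T2, T3) => e.
  by apply: (mulfI N10); lra.
have e2012 : p0 (lie h0 h1) - p3 (lie h0 h2) - p2 (lie h1 h2) = N3 / N2 * k h0.
  have := d2 H0 H1 H2; rewrite !(lE w2) // !(pN _ h0 h2) // !(T1, T2, T3) => e.
  by apply: (mulfI N20); lra.
have e2013 : - p1 (lie h0 h1) - p3 (lie h0 h3) - p2 (lie h1 h3) = - N3 / N2 * k h1.
  have := d2 H0 H1 H3; rewrite !(lE w2) // !(pN _ h0 h3) // !(T1, T2, T3) => e.
  by apply: (mulfI N20); lra.
have e2023 : - p1 (lie h0 h2) - p0 (lie h0 h3) - p2 (lie h2 h3) = - N3 / N2 * k h2.
  have := d2 H0 H2 H3; rewrite !(lE w2) // !(pN _ h0 h3) // !(T1, T2, T3) => e.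
  by apply: (mulfI N20); lra.
have e2123 : - p1 (lie h1 h2) - p0 (lie h1 h3) + p3 (lie h2 h3) = N3 / N2 * k h3.
  have := d2 H1 H2 H3; rewrite !(lE w2) // !(pN _ h1 h3) // !(T1, T2, T3) => e.
  by apply: (mulfI N20); lra.
have e3012 : p1 (lie h0 h1) + p2 (lie h0 h2) - p3 (lie h1 h2) = 0.
  have := d3 H0 H1 H2; rewrite !(lE w3) // !(pN _ h0 h2) // !(T1, T2, T3) => e.
  by apply: (mulfI N30); lra.
have e3013 : p0 (lie h0 h1) + p2 (lie h0 h3) - p3 (lie h1 h3) = 0.
  have := d3 H0 H1 H3; rewrite !(lE w3) // !(pN _ h0 h3) // !(T1, T2, T3) => e.
  by apply: (mulfI N30); lra.
have e3023 : p0 (lie h0 h2) - p1 (lie h0 h3) - p3 (lie h2 h3) = 0.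
  have := d3 H0 H2 H3; rewrite !(lE w3) // !(pN _ h0 h3) // !(T1, T2, T3) => e.
  by apply: (mulfI N30); lra.
have e3123 : p0 (lie h1 h2) - p1 (lie h1 h3) - p2 (lie h2 h3) = 0.
  have := d3 H1 H2 H3; rewrite !(lE w3) // !(pN _ h1 h3) // !(T1, T2, T3) => e.
  by apply: (mulfI N30); lra.
by do !split; lra.
Qed.

(** [ad x y z] is p([x,[y,z]]) with the inner bracket expanded in the frame, which turns the Jacobi
    identity into a quadratic relation between structure constants. *)
Lemma frame_jacobi (p0 p1 p2 p3 p : g -> R) a b c :
  (forall phi y, linform phi -> y \in H ->
     phi y = p0 y * phi h0 + p1 y * phi h1 + p2 y * phi h2 + p3 y * phi h3) ->
  linform p -> a \in H -> b \in H -> c \in H ->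
  let ad x y z := p0 (lie y z) * p (lie x h0) + p1 (lie y z) * p (lie x h1)
    + p2 (lie y z) * p (lie x h2) + p3 (lie y z) * p (lie x h3) in
  ad a b c + ad b c a + ad c a b = 0.
Proof.
move=> pE lin aH bH cH ad.
have adE x y z : y \in H -> z \in H -> ad x y z = p (lie x (lie y z)).
  move=> yH zH; rewrite (pE (fun v => p (lie x v)) (lie y z)) ?Hlie //.
  by move=> e u v; rewrite liePr lin.
have pD u v : p (u + v) = p u + p v by rewrite -[u in LHS]scale1r lin mul1r.
by rewrite !adE // -!pD lie_jacobi (linform0 lin).
Qed.

Lemma linform_lieN (p : g -> R) x y : linform p -> p (lie y x) = - p (lie x y).
Proof. by move=> lin; rewrite lieC -scaleN1r -[_ *: _]addr0 lin linform0 //; ring. Qed.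

Lemma frame_abelian x y : k h0 = 0 -> k h1 = 0 -> k h2 = 0 -> k h3 = 0 ->
  x \in H -> y \in H -> lie x y = 0.
Proof.
move=> k0 k1 k2 k3 xH yH.
have [p0 [p1 [p2 [p3 [pinj [L0 L1 L2 L3] pE]]]]] := frame_structure.
rewrite k0 k1 k2 k3 !mulr0 !addr0 !subr0.
move=> [[e120 e121 e122 e123] [e130 e131 e132 e133] [e230 e231 e232 e233]].
have [_ _ _ [H0 H1 H2 H3] _] := fr.
have J0 := frame_jacobi pE L0 H1 H2 H3; have J1 := frame_jacobi pE L1 H0 H2 H3.
have J2 := frame_jacobi pE L2 H0 H1 H3; have J3 := frame_jacobi pE L3 H0 H1 H2.
have N (p : g -> R) a b : linform p -> p (lie b a) = - p (lie a b) by apply: linform_lieN.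
move: J0 J1 J2 J3; cbv beta zeta.
rewrite !liexx !(linform0 L0) !(linform0 L1) !(linform0 L2) !(linform0 L3).
have M := (N _ h0 h1 L0, N _ h0 h2 L0, N _ h0 h3 L0, N _ h1 h2 L0, N _ h1 h3 L0, N _ h2 h3 L0,
  N _ h0 h1 L1, N _ h0 h2 L1, N _ h0 h3 L1, N _ h1 h2 L1, N _ h1 h3 L1, N _ h2 h3 L1,
  N _ h0 h1 L2, N _ h0 h2 L2, N _ h0 h3 L2, N _ h1 h2 L2, N _ h1 h3 L2, N _ h2 h3 L2,
  N _ h0 h1 L3, N _ h0 h2 L3, N _ h0 h3 L3, N _ h1 h2 L3, N _ h1 h3 L3, N _ h2 h3 L3).
rewrite !M e120 e121 e122 e123 e130 e131 e132 e133 e230 e231 e232 e233 => J0 J1 J2 J3.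
have := @hyperkaehler_sos R (p0 (lie h0 h1)) (p1 (lie h0 h1)) (p2 (lie h0 h1)) (p3 (lie h0 h1))
 (p0 (lie h0 h2)) (p1 (lie h0 h2)) (p2 (lie h0 h2)) (p3 (lie h0 h2))
 (p0 (lie h0 h3)) (p1 (lie h0 h3)) (p2 (lie h0 h3)) (p3 (lie h0 h3)).
case; first lra.
move=> [c010 c011 c012 c013] [c020 c021 c022 c023] [c030 c031 c032 c033].
have z01 : lie h0 h1 = 0 by apply: pinj => //; apply: Hlie.
have z02 : lie h0 h2 = 0 by apply: pinj => //; apply: Hlie.
have z03 : lie h0 h3 = 0 by apply: pinj => //; apply: Hlie.
have z12 : lie h1 h2 = 0 by apply: pinj; [exact: Hlie|lra..].
have z13 : lie h1 h3 = 0 by apply: pinj; [exact: Hlie|lra..].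
have z23 : lie h2 h3 = 0 by apply: pinj; [exact: Hlie|lra..].
have pxy p : linform p -> p (lie x y) = 0.
  move=> lin; rewrite (pE (fun v => p (lie x v)) y) //; last by move=> c u v; rewrite liePr lin.
  rewrite !(pE (fun v => p (lie v _)) x) //; try by move=> c u v; rewrite liePl lin.
  rewrite !liexx !(lieC h0) !(lieC h1 h2) !(lieC h1 h3) !(lieC h2 h3) z01 z02 z03 z12 z13 z23.
  by rewrite !oppr0 !(linform0 lin) !(mulr0, addr0).
by apply: pinj; rewrite ?pxy // Hlie.
Qed.

(** On the frame k is nonzero only at h0, and it kills brackets, so all brackets lie in the span of
    h1, h2, h3. The equation for gam and two Jacobi identities then become the hypotheses of
    [frobenius_contradiction]. *)
Lemma frame_frobenius (gam : g -> R) s : linform k -> linform gam -> s != 0 ->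
  (forall x y, x \in H -> y \in H -> k (lie x y) = 0) ->
  (forall x y, x \in H -> y \in H -> gam (lie x y) = s * w3 x y) ->
  k h0 != 0 -> k h1 = 0 -> k h2 = 0 -> k h3 = 0 -> False.
Proof.
move=> klin glin s0 klie glie k0 k1 k2 k3.
have [p0 [p1 [p2 [p3 [pinj [L0 L1 L2 L3] pE]]]]] := frame_structure.
rewrite k1 k2 k3 !mulr0 !addr0 !subr0.
move=> [[e120 e121 e122 e123] [e130 e131 e132 e133] [e230 e231 e232 e233]].
have [[a1 a2 a3] [N10 N20 N30] [s1 s2 s3] [H0 H1 H2 H3] _] := fr.
have p0lie x y : x \in H -> y \in H -> p0 (lie x y) = 0.
  move=> xH yH; have := klie x y xH yH.
  rewrite (pE k (lie x y)) ?Hlie // k1 k2 k3 !mulr0 !addr0 => /eqP.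
  by rewrite mulf_eq0 (negPf k0) orbF => /eqP.
have gE x y : x \in H -> y \in H ->
    p1 (lie x y) * gam h1 + p2 (lie x y) * gam h2 + p3 (lie x y) * gam h3 = s * w3 x y.
  move=> xH yH; rewrite -glie // (pE gam (lie x y)) ?Hlie //.
  by rewrite p0lie // mul0r add0r.
move: e120 e130 e230; rewrite !p0lie // mulr0 !subr0 => e120 e130 e230.
have T3 := std_pairing_table a3 s3.
have J2 := frame_jacobi pE L2 H0 H1 H3; have J1 := frame_jacobi pE L1 H0 H2 H3.
have N (p : g -> R) a b : linform p -> p (lie b a) = - p (lie a b) by apply: linform_lieN.
move: J1 J2 e121 e122 e123 e131 e132 e133 e231 e232 e233
  (gE _ _ H0 H1) (gE _ _ H0 H2) (gE _ _ H0 H3) (gE _ _ H1 H2) (gE _ _ H1 H3) (gE _ _ H2 H3).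
rewrite !T3; cbv beta zeta.
rewrite !liexx !(linform0 L1) !(linform0 L2).
have M := (
  N _ h0 h1 L1, N _ h0 h2 L1, N _ h0 h3 L1, N _ h1 h2 L1, N _ h1 h3 L1, N _ h2 h3 L1,
  N _ h0 h1 L2, N _ h0 h2 L2, N _ h0 h3 L2, N _ h1 h2 L2, N _ h1 h3 L2, N _ h2 h3 L2,
  N _ h0 h1 L3, N _ h0 h2 L3, N _ h0 h3 L3, N _ h1 h2 L3, N _ h1 h3 L3, N _ h2 h3 L3).
rewrite !p0lie // !M.
set t := N3 / N2 * k h0 in e230 *.
move=> + + e121 e122 e123 e131 e132 e133 e231 e232 e233.
(* The matrix of ad h0 on h1, h2, h3 is symmetric up to the defect t, which comes from d w2 = k /\
   w3. *)
have c021 : p1 (lie h0 h2) = p2 (lie h0 h1) by lra.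
have c031 : p1 (lie h0 h3) = p3 (lie h0 h1) by lra.
have c032 : p2 (lie h0 h3) = p3 (lie h0 h2) + t by lra.
rewrite e121 e122 e123 e131 e132 e133 e231 e232 e233 c021 c031 c032.
move=> J1 J2 G01 G02 G03 G12 G13 G23.
apply: (@frobenius_contradiction R (p1 (lie h0 h1)) (p2 (lie h0 h1)) (p3 (lie h0 h1))
  (p2 (lie h0 h2)) (p3 (lie h0 h2)) (p3 (lie h0 h3)) t (gam h1) (gam h2) (gam h3) (s * N3));
  by rewrite ?mulf_neq0 //; lra.
Qed.


End Coordinates.
End Frame.

(** * Normal form of a triple of 2-forms *)

Section Triple.
Variables (R : realType) (g : lieAlgType R).
Implicit Types (x y z t : g) (w : g -> g -> R).

Lemma alt2_rules w : alt2 w ->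
  (forall x y z, w (x + y) z = w x z + w y z) * (forall x y z, w z (x + y) = w z x + w z y) *
  (forall c x z, w (c *: x) z = c * w x z) * (forall c x z, w z (c *: x) = c * w z x) *
  (forall x z, w (- x) z = - w x z) * (forall x z, w z (- x) = - w z x).
Proof.
move=> aw; have [Lr Ll] := linform_alt2 aw.
have D1 x y z : w (x + y) z = w x z + w y z.
  by have := Ll z 1 x y; rewrite scale1r mul1r.
have D2 x y z : w z (x + y) = w z x + w z y.
  by have := Lr z 1 x y; rewrite scale1r mul1r.
have Z1 c x z : w (c *: x) z = c * w x z.
  by have := Ll z c x 0; rewrite addr0 => ->; rewrite (linform0 (Ll z)) addr0.
have Z2 c x z : w z (c *: x) = c * w z x.
  by have := Lr z c x 0; rewrite addr0 => ->; rewrite (linform0 (Lr z)) addr0.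
by do !split=> //= *; rewrite -scaleN1r ?Z1 ?Z2 mulN1r.
Qed.

Lemma linform_rules (phi : g -> R) : linform phi ->
  (forall x y, phi (x + y) = phi x + phi y) * (forall c x, phi (c *: x) = c * phi x) *
  (forall x, phi (- x) = - phi x).
Proof.
move=> lin; have Z c x : phi (c *: x) = c * phi x.
  by rewrite -[c *: x]addr0 lin (linform0 lin) addr0.
split=> [|x]; last by rewrite -scaleN1r Z mulN1r.
by split=> // x y; rewrite -[x in LHS]scale1r lin mul1r.
Qed.

Definition wedge22 w w' x y z t : R :=
  w x y * w' z t - w x z * w' y t + w x t * w' y z
  + w y z * w' x t - w y t * w' x z + w z t * w' x y.

(** What is kept on H, without the bracket, for w1 = f, w2 = r(., ., e5), w3 = r(., ., e6), gam =
    r(., e5, e6). Nondegeneracy of r(x, ., .) yields [tri_det] for x in H and [tri_pfaff] for x = a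
    e5 + b e6. *)
Record triple (H : {vspace g}) w1 w2 w3 (gam : g -> R) : Prop := Triple {
  tri_alt : [/\ alt2 w1, alt2 w2 & alt2 w3];
  tri_gam : linform gam;
  tri_dim : \dim H = 4;
  tri_neq0 : forall x, x \in H -> x != 0 -> exists2 y, y \in H & w1 x y != 0;
  tri_det : forall x, x \in H -> x != 0 -> gam x = 0 -> exists n1 n2,
    [/\ n1 \in H, n2 \in H, w1 x n1 = 0, w1 x n2 = 0
      & w2 x n1 * w3 x n2 - w3 x n1 * w2 x n2 != 0];
  tri_pfaff : forall a b x y z t, (a != 0) || (b != 0) -> free [:: x; y; z; t] ->
    x \in H -> y \in H -> z \in H -> t \in H ->
    pfaff (fun u v => a * w2 u v + b * w3 u v) x y z t != 0;
  tri_wedge : forall x y z t, x \in H -> y \in H -> z \in H -> t \in H ->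
    wedge22 w1 w2 x y z t = 0 /\ wedge22 w1 w3 x y z t = 0 }.

(** This is the passage from e5 to e5 - kap e6: a column operation preserves the determinant, and
    the pencil of w2 and w3 is reparametrized. *)
Lemma triple_shift H w1 w2 w3 gam kap : triple H w1 w2 w3 gam ->
  triple H w1 (fun x y => w2 x y - kap * w3 x y) w3 gam.
Proof.
case=> [[a1 a2 a3] lin dimH n0 det pf wd].
have [P2 C2] := a2; have [P3 C3] := a3.
split=> //.
- by split=> //; split=> [c x y z|x y]; rewrite ?P2 ?P3 1?C2 1?C3; ring.
- move=> x xH x0 gx; have [n1 [n2 [n1H n2H e1 e2 D]]] := det x xH x0 gx.
  exists n1, n2; split=> //; apply: contraNneq D => D; apply/eqP; lra.
- move=> a b x y z t ab fr xH yH zH tH.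
  have ab' : (a != 0) || (b - a * kap != 0).
    by case: (eqVneq a 0) ab => [->|//] /=; rewrite mul0r subr0.
  apply: contraNneq (pf a (b - a * kap) x y z t ab' fr xH yH zH tH) => pf0; apply/eqP.
  by rewrite -[RHS]pf0 /pfaff; ring.
- move=> x y z t xH yH zH tH; have [wd2 wd3] := wd x y z t xH yH zH tH; split=> //.
  transitivity (wedge22 w1 w2 x y z t - kap * wedge22 w1 w3 x y z t); last by rewrite wd2 wd3; ring.
  by rewrite /wedge22; ring.
Qed.

Section Frame.
Variables (H : {vspace g}) (w1 w2 w3 : g -> g -> R) (gam : g -> R).
Hypothesis tri : triple H w1 w2 w3 gam.

Definition dual_vectors h0 h1 h2 h3 : Prop :=
  [/\ [/\ h0 \in H, h1 \in H, h2 \in H, h3 \in H & gam h0 = 0],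
      [/\ w1 h0 h1 = 1, w1 h0 h2 = 0 & w1 h0 h3 = 0],
      [/\ w2 h0 h1 = 0, w2 h0 h2 = 1 & w2 h0 h3 = 0]
    & [/\ w3 h0 h1 = 0, w3 h0 h2 = 0 & w3 h0 h3 = 1]].

(** Taking h0 in ker gam makes [tri_det] applicable, so the three forms w_i(h0, .) are independent
    and have dual vectors. *)
Lemma dual_vectors_exist : exists h0 h1 h2 h3, dual_vectors h0 h1 h2 h3.
Proof.
have [[a1 a2 a3] lin dimH n0 det _ _] := tri.
have r1 := alt2_rules a1; have r2 := alt2_rules a2; have r3 := alt2_rules a3.
have [h0 [h0H h00 gh0]] : exists h0, [/\ h0 \in H, h0 != 0 & gam h0 = 0].
  have [K [KP Kd]] := linform_ker lin.
  have d : (0 < \dim (H :&: K))%N by have := Kd H; rewrite dimH; lia.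
  exists (vpick (H :&: K)%VS); rewrite vpick0 -dimv_eq0 -lt0n d.
  by have := memv_pick (H :&: K)%VS; rewrite memv_cap KP => /andP[-> /eqP].
have [n1 [n2 [n1H n2H e1 e2 D0]]] := det _ h0H h00 gh0.
have [p pH p0] := n0 _ h0H h00.
set D := (X in X != 0) in D0.
(* Cramer's rule for w2(h0, .) and w3(h0, .) on the span of n1 and n2, where w1(h0, .) vanishes. *)
pose h2 := D^-1 *: (w3 h0 n2 *: n1 - w3 h0 n1 *: n2).
pose h3 := D^-1 *: (w2 h0 n1 *: n2 - w2 h0 n2 *: n1).
pose q := (w1 h0 p)^-1 *: p.
have h2H : h2 \in H by rewrite rpredZ ?rpredB ?rpredZ.
have h3H : h3 \in H by rewrite rpredZ ?rpredB ?rpredZ.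
have qH : q \in H by rewrite rpredZ.
have [w12 w22 w32] : [/\ w1 h0 h2 = 0, w2 h0 h2 = 1 & w3 h0 h2 = 0].
  rewrite /h2 !(r1, r2, r3) e1 e2; split; first ring; last by ring.
  by rewrite -(mulVf D0) /D; ring.
have [w13 w23 w33] : [/\ w1 h0 h3 = 0, w2 h0 h3 = 0 & w3 h0 h3 = 1].
  rewrite /h3 !(r1, r2, r3) e1 e2; split; [ring|ring|].
  by rewrite -(mulVf D0) /D; ring.
have q1 : w1 h0 q = 1 by rewrite /q r1 mulVf.
clearbody h2 h3 q.
exists h0, (q - w2 h0 q *: h2 - w3 h0 q *: h3), h2, h3; split=> //.
- by split=> //; apply: memvB; [apply: memvB => //|]; apply: memvZ.
- by split=> //; rewrite !r1 w12 w13 q1; ring.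
- by split=> //; rewrite !r2 w22 w23; ring.
- by split=> //; rewrite !r3 w32 w33; ring.
Qed.

(** The forms w_i(h0, .) separate h1, h2, h3. They all vanish at h0, so h0 in the span of the others
    would be zero. *)
Lemma dual_vectors_free h0 h1 h2 h3 : dual_vectors h0 h1 h2 h3 -> free [:: h0; h1; h2; h3].
Proof.
have [[a1 a2 a3] _ _ _ _ _ _] := tri.
move=> [_ [w101 w102 w103] [w201 w202 w203] [w301 w302 w303]].
have [_ C1] := a1; have x1 := alt2xx h0 a1; have x2 := alt2xx h0 a2; have x3 := alt2xx h0 a3.
have notin (phi : g -> R) x s : linform phi -> all (fun y => phi y == 0) s -> phi x != 0 ->
    x \notin <<s>>%VS.
  by move=> lin s0; apply: contra => /(span_linear0 lin)->.
have [L1 _] := linform_alt2 a1; have [L2 _] := linform_alt2 a2; have [L3 _] := linform_alt2 a3.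
have fr3 : free [:: h1; h2; h3].
  rewrite !free_cons !nil_free !andbT; apply/and3P; split.
  - by apply: (notin _ _ _ (L1 h0)); rewrite /= ?w102 ?w103 ?w101 ?eqxx ?oner_eq0.
  - by apply: (notin _ _ _ (L2 h0)); rewrite /= ?w203 ?w202 ?eqxx ?oner_eq0.
  - by apply: (notin _ _ _ (L3 h0)); rewrite /= ?w303 ?oner_eq0.
rewrite free_cons fr3 andbT; apply/negP => /span_consP[c1 [y1]].
move=> /span_consP[c2 [y2 /span_consP[c3 [y3]]]]; rewrite span_nil memv0 => /eqP-> -> -> e.
have e1 : c1 = 0 by move: x1; rewrite {2}e !L1 (linform0 (L1 h0)) w101 w102 w103; lra.
have e2 : c2 = 0 by move: x2; rewrite {2}e !L2 (linform0 (L2 h0)) w201 w202 w203; lra.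
have e3 : c3 = 0 by move: x3; rewrite {2}e !L3 (linform0 (L3 h0)) w301 w302 w303; lra.
have h00 : h0 = 0 by rewrite e e1 e2 e3 !scale0r !addr0.
by move: w101; rewrite h00 C1 (linform0 (L1 h1)) => /eqP; rewrite oppr0 eq_sym oner_eq0.
Qed.

End Frame.

Definition diag_vectors (H : {vspace g}) w1 w2 w3 (gam : g -> R)
    h0 h1 h2 h3 (m1 m2 m3 : R) : Prop :=
  [/\ [/\ h0 \in H, h1 \in H, h2 \in H, h3 \in H & gam h0 = 0 :> R],
      std_pairing w1 1 m1 h0 h1 h2 h3, std_pairing w2 1 m2 h0 h2 h3 h1
    & std_pairing w3 1 m3 h0 h3 h1 h2].

(* [kap] achieves w2 /\ w3 = 0; adding multiples of [h0] to the other vectors *)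
(* then removes the skew part of the matrix m, where w_i h_j h_k = m_il eps_ljk. *)
Lemma diag_vectors_exist H w1 w2 w3 gam : triple H w1 w2 w3 gam ->
  exists kap h0 h1 h2 h3 m1 m2 m3,
    diag_vectors H w1 (fun x y => w2 x y - kap * w3 x y) w3 gam h0 h1 h2 h3 m1 m2 m3.
Proof.
move=> tri; have [h0 [h1 [h2 [h3 dual]]]] := dual_vectors_exist tri.
have fr := dual_vectors_free tri dual.
have [[a1 a2 a3] glin dimH n0 det pf wd] := tri.
have [[h0H h1H h2H h3H gh0] [w101 w102 w103] [w201 w202 w203] [w301 w302 w303]] := dual.
have r1 := alt2_rules a1; have r2 := alt2_rules a2; have r3 := alt2_rules a3.
have [_ C1] := a1; have [_ C2] := a2; have [_ C3] := a3.
have m30 : w3 h1 h2 != 0.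
  have := pf 0 1 h0 h1 h2 h3; rewrite oner_eq0 orbT => /(_ isT fr h0H h1H h2H h3H).
  rewrite /pfaff /= w301 w302 w303 w201 w202 w203; apply: contraNneq => ->; apply/eqP; ring.
have [W12 W13] := wd _ _ _ _ h0H h1H h2H h3H.
(* Solves for the vanishing of (w2 - kap w3) /\ w3. *)
pose kap := (w2 h1 h2 + w3 h3 h1) / (2 * w3 h1 h2).
have kapE : 2 * w3 h1 h2 * kap = w2 h1 h2 + w3 h3 h1.
  by rewrite /kap mulrC divfK // mulf_neq0 // pnatr_eq0.
(* Since v2(h0, h3) = - kap, adding kap h2 restores v2(h0, h3') = 0. *)
pose h3' := h3 + kap *: h2.
pose v2 x y := w2 x y - kap * w3 x y.
move: W12 W13; rewrite /wedge22 w101 w102 w103 w201 w202 w203 w301 w302 w303 => W12 W13.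
(* Vanishing wedge products make opposite off-diagonal entries of m negatives of each other, so a
   single n_j cancels both. *)
pose n1 := w3 h3' h1; pose n2 := w1 h1 h2; pose n3 := v2 h2 h3'.
exists kap, h0, (h1 + n1 *: h0), (h2 + n2 *: h0), (h3' + n3 *: h0).
exists (w1 h2 h3'), (v2 h3' h1), (w3 h1 h2).
have T w : alt2 w -> (w h0 h0 = 0) * (w h1 h1 = 0) * (w h2 h2 = 0) * (w h3 h3 = 0) *
    (w h1 h0 = - w h0 h1) * (w h2 h0 = - w h0 h2) * (w h3 h0 = - w h0 h3) *
    (w h2 h1 = - w h1 h2) * (w h3 h1 = - w h1 h3) * (w h3 h2 = - w h2 h3).
  by move=> aw; have [_ C] := aw; rewrite !(alt2xx _ aw) (C h0 h1) (C h0 h2) (C h0 h3)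
    (C h1 h2) (C h1 h3) (C h2 h3).
have [T1 T2 T3] := And3 (T _ a1) (T _ a2) (T _ a3).
have kW := congr1 ( *%R kap) W13.
rewrite T3 in kapE.
split.
- have h3'H : h3' \in H by apply: memvD => //; apply: memvZ.
  by split=> //; apply: memvD => //; apply: memvZ.
- by split; split; rewrite /n1 /n2 /n3 /v2 /h3' !(r1, r2, r3) !(T1, T2, T3) ?w101 ?w102 ?w103; lra.
- by split; split; rewrite /n1 /n2 /n3 /v2 /h3' !(r1, r2, r3) !(T1, T2, T3)
    ?w201 ?w202 ?w203 ?w301 ?w302 ?w303; lra.
- by split; split; rewrite /n1 /n2 /n3 /v2 /h3' !(r1, r2, r3) ?(T1, T2, T3) ?w301 ?w302 ?w303; lra.
Qed.

Lemma isotropic_pair (a b : R) : a * b <= 0 ->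
  exists x y : R, ((x != 0) || (y != 0)) /\ a * (x * x) + b * (y * y) = 0.
Proof.
move=> ab; case: (eqVneq a 0) => [->|a0].
  by exists 1, 0; rewrite oner_eq0; split=> //; ring.
exists (Num.sqrt `|b|), (Num.sqrt `|a|); split.
  by rewrite orbC sqrtr_eq0 -ltNge normr_gt0 a0.
rewrite -!expr2 !sqr_sqrtr ?normr_ge0 //.
case: (ger0P a) => a1; case: (ger0P b) => b1; try ring.
  by have := mulr_ge0 a1 b1; lra.
have : 0 <= - a * - b by rewrite mulr_ge0 // oppr_ge0 ltW.
by move=> ?; lra.
Qed.

(* Otherwise some x in ker gam has w1(x, .) proportional to a combination of *)
(* w2(x, .) and w3(x, .), against [tri_det]. *)
Lemma diag_vectors_sign H w1 w2 w3 gam h0 h1 h2 h3 m1 m2 m3 : triple H w1 w2 w3 gam ->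
  diag_vectors H w1 w2 w3 gam h0 h1 h2 h3 m1 m2 m3 -> 0 < m2 * m3 /\ 0 < m1 * m3.
Proof.
move=> tri [[h0H h1H h2H h3H gh0] s1 s2 s3].
have [[a1 a2 a3] glin dimH n0 det pf wd] := tri.
have r1 := alt2_rules a1; have r2 := alt2_rules a2; have r3 := alt2_rules a3.
have T1 := std_pairing_table a1 s1; have T2 := std_pairing_table a2 s2.
have T3 := std_pairing_table a3 s3.
have dual : dual_vectors H w1 w2 w3 gam h0 h1 h2 h3.
  by split; split=> //; rewrite ?T1 ?T2 ?T3.
have fr := dual_vectors_free tri dual.
have m23 : 0 < m2 * m3.
  (* The Pfaffian of a w2 + b w3 on the frame is a^2 m2 + b^2 m3, which must not have a nontrivial
     zero. *)
  rewrite ltNge; apply/negP => /isotropic_pair[a [b [ab e]]].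
  have /eqP[] := pf a b h0 h1 h2 h3 ab fr h0H h1H h2H h3H.
  by rewrite /pfaff /= !(T2, T3); lra.
split=> //; rewrite ltNge; apply/negP => m13.
(* These coefficients of h2 and h3 put x, defined below, in ker gam. *)
have [y [z [yz yz0]]] : exists y z : R, ((y != 0) || (z != 0)) /\ y * gam h2 + z * gam h3 = 0.
  case: (eqVneq (gam h2) 0) => [->|g2]; first by exists 1, 0; rewrite oner_eq0; split=> //; ring.
  by exists (gam h3), (- gam h2); rewrite oppr_eq0 g2 orbT; split=> //; ring.
pose D := m3 * (y * y) + m2 * (z * z).
have mD : 0 <= - (m1 * D).
  have m12 : m1 * m2 <= 0.
    have m3_gt0 : 0 < m3 * m3.
      by rewrite -expr2 exprn_even_gt0 //=; apply: contraTneq m23 => ->; rewrite mulr0 ltxx.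
    rewrite -(pmulr_lle0 _ m3_gt0).
    have -> : m1 * m2 * (m3 * m3) = (m2 * m3) * (m1 * m3) by ring.
    by rewrite pmulr_rle0.
  have y2 : 0 <= - (m1 * m3) * (y * y) by rewrite mulr_ge0 ?oppr_ge0 // -expr2 sqr_ge0.
  have z2 : 0 <= - (m1 * m2) * (z * z) by rewrite mulr_ge0 ?oppr_ge0 // -expr2 sqr_ge0.
  by rewrite /D; lra.
(* The value for which m1 (y w3(x, .) - z w2(x, .)) = x0 w1(x, .) on H; the component along h1
   forces x0^2 = - m1 D. *)
pose x0 := Num.sqrt (- (m1 * D)).
have x02 : x0 * x0 = - (m1 * D) by rewrite -expr2 sqr_sqrtr.
pose x := x0 *: h0 + y *: h2 + z *: h3.
have xH : x \in H by do 2!(apply: memvD; last exact: memvZ); apply: memvZ.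
have span : (H <= <<[:: h0; h1; h2; h3]>>)%VS.
  have sub : (<<[:: h0; h1; h2; h3]>> <= H)%VS.
    by apply/span_subvP => v; rewrite !inE => /or4P[] /eqP->.
  by rewrite -(geq_leqif (dimv_leqif_sup sub)) (eqP fr) dimH.
have spanE n : n \in H ->
    exists c0 c1 c2 c3, n = c0 *: h0 + (c1 *: h1 + (c2 *: h2 + c3 *: h3)).
  move=> /(subvP span) /span_consP[c0 [y0 /span_consP[c1 [y1 /span_consP[c2 [y2]]]]]].
  move=> /span_consP[c3 [y3]]; rewrite span_nil memv0 => /eqP -> -> -> -> ->.
  by exists c0, c1, c2, c3; rewrite addr0.
have m10 : m1 != 0.
  apply/eqP => m10; have h20 : h2 != 0.
    apply/eqP => h20; move: s2.1 => [+ _ _].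
    by rewrite h20 (linform0 ((linform_alt2 a2).1 h0)) => /eqP; rewrite eq_sym oner_eq0.
  have [n nH] := n0 _ h2H h20; have [c0 [c1 [c2 [c3 ->]]]] := spanE n nH.
  by rewrite !r1 !T1 m10 !mulr0 !addr0 eqxx.
have key n : n \in H -> m1 * (y * w3 x n - z * w2 x n) = x0 * w1 x n.
  move=> nH; have [c0 [c1 [c2 [c3 ->]]]] := spanE n nH.
  rewrite /x !(r1, r2, r3) !(T1, T2, T3).
  have := congr1 ( *%R c1) x02; rewrite /D => e; lra.
have wx : w2 h0 x = y /\ w3 h0 x = z by rewrite /x !(r2, r3) !(T2, T3); split; ring.
have xn0 : x != 0.
  apply: contraTneq yz => x_0; have [<- <-] := wx.
  by rewrite x_0 (linform0 ((linform_alt2 a2).1 h0)) (linform0 ((linform_alt2 a3).1 h0)) eqxx.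
have gx : gam x = 0.
  have rg := linform_rules glin.
  by rewrite /x !rg gh0; lra.
have [n1 [n2 [n1H n2H e1 e2 D0]]] := det x xH xn0 gx.
have k1 : y * w3 x n1 = z * w2 x n1.
  by have := key n1 n1H; rewrite e1 mulr0 => /eqP; rewrite mulf_eq0 (negPf m10) subr_eq0 => /eqP.
have k2 : y * w3 x n2 = z * w2 x n2.
  by have := key n2 n2H; rewrite e2 mulr0 => /eqP; rewrite mulf_eq0 (negPf m10) subr_eq0 => /eqP.
set E := (X in X != 0) in D0.
have yE : y * E = 0.
  rewrite /E; have := congr1 ( *%R (w2 x n1)) k2; have := congr1 ( *%R (w2 x n2)) k1.
  by move=> *; lra.
have zE : z * E = 0.
  rewrite /E; have := congr1 ( *%R (w3 x n1)) k2; have := congr1 ( *%R (w3 x n2)) k1.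
  by move=> *; lra.
by move: yz yE zE => /orP[] /negPf z0 /eqP + /eqP; rewrite !mulf_eq0 z0 (negPf D0).
Qed.

(** The m_i share a sign s by [diag_vectors_sign]. Rescaling h_i by the root of s m_i, and h0 by P,
    equalizes the two constants of each pairing. *)
Lemma frame_exists (H : {vspace g}) w1 w2 w3 gam : triple H w1 w2 w3 gam ->
  exists kap N1 N2 N3 h0 h1 h2 h3,
    frame H w1 (fun x y => w2 x y - kap * w3 x y) w3 N1 N2 N3 h0 h1 h2 h3.
Proof.
move=> tri; have [kap [h0 [h1 [h2 [h3 [m1 [m2 [m3 diag]]]]]]]] := diag_vectors_exist tri.
have tri' := triple_shift kap tri.
have [m23 m13] := diag_vectors_sign tri' diag.
exists kap; set v2 := (fun x y => _) in tri' diag *; clearbody v2.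
have [[a1 a2 a3] _ dimH _ _ _ _] := tri'.
have [[h0H h1H h2H h3H _] s1 s2 s3] := diag.
have r1 := alt2_rules a1; have r2 := alt2_rules a2; have r3 := alt2_rules a3.
have T1 := std_pairing_table a1 s1; have T2 := std_pairing_table a2 s2.
have T3 := std_pairing_table a3 s3.
have [s [ss sm3]] : exists s : R, s * s = 1 /\ 0 < s * m3.
  case: (ltrgtP m3 0) => m30; [exists (-1)|exists 1|by move: m23; rewrite m30 mulr0 ltxx].
    by split; lra.
  by split; lra.
have sm m : 0 < m * m3 -> 0 < s * m.
  move=> mm; rewrite -(pmulr_lgt0 _ sm3).
  have -> : s * m * (s * m3) = (s * s) * (m * m3) by ring.
  by rewrite ss mul1r.
have [u1 u2 u3] := And3 (sm _ m13) (sm _ m23) sm3.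
pose q m := Num.sqrt (s * m).
have qq m : 0 < s * m -> q m * q m = s * m by move=> ?; rewrite /q -expr2 sqr_sqrtr // ltW.
have [q1 q2 q3] := And3 (qq _ u1) (qq _ u2) (qq _ u3).
have q0 m : 0 < s * m -> q m != 0 by move=> ?; rewrite gt_eqF // sqrtr_gt0.
have s0 : s != 0 by apply: contraTneq u1 => ->; rewrite mul0r ltxx.
pose P := s * q m1 * q m2 * q m3.
have P0 : P != 0 by rewrite !mulf_neq0 ?q0.
exists (P * q m1), (P * q m2), (P * q m3), (P *: h0), (q m1 *: h1), (q m2 *: h2), (q m3 *: h3).
clearbody q.
split.
- by [].
- by rewrite !mulf_neq0 ?q0.
- split; split; split; rewrite !(r1, r2, r3) !(T1, T2, T3).
  all: rewrite ?(mulr0, mulr1) //.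
  + by have := congr1 ( *%R (q m2 * q m3 * s)) q1; have := congr1 ( *%R (q m2 * q m3 * m1)) ss;
      rewrite /P => *; lra.
  + by have := congr1 ( *%R (q m3 * q m1 * s)) q2; have := congr1 ( *%R (q m3 * q m1 * m2)) ss;
      rewrite /P => *; lra.
  + by have := congr1 ( *%R (q m1 * q m2 * s)) q3; have := congr1 ( *%R (q m1 * q m2 * m3)) ss;
      rewrite /P => *; lra.
- by split; apply: memvZ.
- by rewrite dimH.
Qed.
End Triple.

(** * The two cases for k on a framed subalgebra *)

Section FrameConclusion.
Variables (R : realType) (g : lieAlgType R).

(* In quaternionic notation, the frame is multiplied by k0 + k1 i + k2 j + k3 k. *)
Lemma frame_rotate (H : {vspace g}) w1 w2 w3 N1 N2 N3 h0 h1 h2 h3 (k : g -> R) :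
  frame H w1 w2 w3 N1 N2 N3 h0 h1 h2 h3 -> linform k ->
  ~~ [&& k h0 == 0, k h1 == 0, k h2 == 0 & k h3 == 0] ->
  exists M1 M2 M3 v0 v1 v2 v3, frame H w1 w2 w3 M1 M2 M3 v0 v1 v2 v3 /\
    [/\ k v0 != 0, k v1 = 0, k v2 = 0 & k v3 = 0].
Proof.
case=> [[a1 a2 a3] [N10 N20 N30] [s1 s2 s3] [h0H h1H h2H h3H] dimH] lin kn0.
have r1 := alt2_rules a1; have r2 := alt2_rules a2; have r3 := alt2_rules a3.
have T1 := std_pairing_table a1 s1; have T2 := std_pairing_table a2 s2.
have T3 := std_pairing_table a3 s3; have rk := linform_rules lin.
pose n := k h0 * k h0 + k h1 * k h1 + k h2 * k h2 + k h3 * k h3.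
have n0 : n != 0.
  apply: contraNN kn0 => /eqP n0.
  have := sqr_ge0 (k h0); have := sqr_ge0 (k h1); have := sqr_ge0 (k h2).
  have := sqr_ge0 (k h3); rewrite !expr2 => d3 d2 d1 d0.
  have z u : u * u <= 0 -> u == 0 :> R by move=> ?; rewrite -sqrf_eq0 eq_le sqr_ge0 andbT expr2.
  by move: n0; rewrite /n => n0; apply/and4P; split; apply: z; lra.
exists (N1 * n), (N2 * n), (N3 * n).
exists (k h0 *: h0 + k h1 *: h1 + k h2 *: h2 + k h3 *: h3).
exists (k h0 *: h1 - k h1 *: h0 + k h2 *: h3 - k h3 *: h2).
exists (k h0 *: h2 - k h2 *: h0 + k h3 *: h1 - k h1 *: h3).
exists (k h0 *: h3 - k h3 *: h0 + k h1 *: h2 - k h2 *: h1).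
split; last first.
  rewrite !rk; split; [|ring|ring|ring].
  by apply: contraNneq n0 => e; apply/eqP; rewrite -[RHS]e /n; ring.
split=> //.
- by rewrite !mulf_neq0.
- by split; split; split; rewrite /n !(r1, r2, r3) !(T1, T2, T3); ring.
- by split; do ?[apply: memvD|apply: memvB]; rewrite ?memvN; apply: memvZ.
Qed.

(** If k vanishes on the frame, H is abelian and evaluating gam on [h0, h3] gives s = 0. Otherwise s
    is nonzero, and rotating the frame so that k lives on h0 leads to [frame_frobenius]. *)
Lemma frame_conclusion (H : {vspace g}) w1 w2 w3 N1 N2 N3 h0 h1 h2 h3 (k gam : g -> R) s :
  frame H w1 w2 w3 N1 N2 N3 h0 h1 h2 h3 ->
  (forall x y, x \in H -> y \in H -> lie x y \in H) ->
  (forall x y z, x \in H -> y \in H -> z \in H ->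
    w1 (lie x y) z + w1 (lie y z) x + w1 (lie z x) y = 0) ->
  (forall x y z, x \in H -> y \in H -> z \in H ->
    w2 (lie x y) z + w2 (lie y z) x + w2 (lie z x) y =
    k x * w3 y z + k y * w3 z x + k z * w3 x y) ->
  (forall x y z, x \in H -> y \in H -> z \in H ->
    w3 (lie x y) z + w3 (lie y z) x + w3 (lie z x) y = 0) ->
  linform k -> linform gam ->
  (forall x y, x \in H -> y \in H -> k (lie x y) = 0) ->
  (forall x y, x \in H -> y \in H -> gam (lie x y) = s * w3 x y) ->
  (s = 0 -> forall x, x \in H -> k x = 0) ->
  s = 0 /\ (forall x y, x \in H -> y \in H -> lie x y = 0).
Proof.
move=> fr Hlie d1 d2 d3 klin glin klie glie sk.
have [_ [_ _ N30] [_ _ s3] [h0H h1H h2H h3H] _] := fr.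
case: (boolP [&& k h0 == 0, k h1 == 0, k h2 == 0 & k h3 == 0]) => [|kn0].
  move=> /and4P[/eqP k0 /eqP k1 /eqP k2 /eqP k3].
  have ab x y : x \in H -> y \in H -> lie x y = 0.
    exact: (frame_abelian fr Hlie d1 d2 d3 k0 k1 k2 k3).
  split=> //; have := glie h0 h3 h0H h3H; rewrite ab // (linform0 glin).
  have [[-> _ _] _] := s3.
  by move=> /esym/eqP; rewrite mulf_eq0 (negPf N30) orbF => /eqP.
have [M1 [M2 [M3 [v0 [v1 [v2 [v3 [fr' [k0 k1 k2 k3]]]]]]]]] := frame_rotate fr klin kn0.
case: (eqVneq s 0) => [s0|s0].
  by have [_ _ _ [v0H _ _ _] _] := fr'; rewrite (sk s0 v0 v0H) eqxx in k0.
by case: (frame_frobenius fr' Hlie d1 d2 d3 klin glin s0 klie glie k0 k1 k2 k3).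
Qed.

End FrameConclusion.

(** * Symplectic half-flat structures on a direct sum *)

Section LinearAlgebra.
Variables (K : fieldType) (V : vectType K).
Implicit Types (U W : {vspace V}) (s t : seq V).

Lemma free_extend U s : free s -> {subset s <= U} -> (size s < \dim U)%N ->
  exists2 v, v \in U & free (rcons s v).
Proof.
move=> fs sU lt_s.
have [v vU vs] : exists2 v, v \in U & v \notin <<s>>%VS.
  apply/subvPn; apply: contraTN lt_s => /dimvS; rewrite -leqNgt.
  by move=> /leq_trans; apply; apply: dim_span.
exists v => //; have /perm_free -> : perm_eq (rcons s v) (v :: s) by rewrite perm_rcons.
by rewrite free_cons vs.
Qed.

Lemma free2P (x y : V) :
  reflect (forall a b, a *: x + b *: y = 0 -> a = 0 /\ b = 0) (free [:: x; y]).
Proof.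
rewrite free_cons seq1_free span_seq1; apply: (iffP andP) => [[xy y0] a b e|ind].
  have a0 : a = 0.
    apply/eqP; apply: contraNT xy => a0; apply/vlineP; exists (- (a^-1 * b)).
    apply: (scalerI a0); move/eqP: e; rewrite addr_eq0 => /eqP->.
    by rewrite scaleNr scalerN scalerA mulrA divff ?mul1r.
  by move: e => /eqP; rewrite a0 scale0r add0r scaler_eq0 (negPf y0) orbF => /eqP.
split; last first.
  apply/eqP => y0; have [] := ind 0 1; rewrite ?y0 ?scale0r ?scaler0 ?addr0 // => _ /eqP.
  by rewrite oner_eq0.
apply/vlineP => -[c xE]; have [] := ind 1 (- c); first by rewrite xE scale1r scaleNr subrr.
by move=> /eqP; rewrite oner_eq0.
Qed.

Lemma free_cat2 U W s t : free s -> free t -> {subset s <= U} -> {subset t <= W} ->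
  (U :&: W = 0)%VS -> free (s ++ t).
Proof.
move=> fs ft sU tW UW; rewrite cat_free fs ft; apply/directv_addP/eqP.
rewrite -subv0 -UW; apply: capvS; apply/span_subvP => v; [exact: sU|exact: tW].
Qed.

End LinearAlgebra.

Section Data.
Variables (R : realType) (g : lieAlgType R) (f : g -> g -> R) (r : g -> g -> g -> R).
Hypothesis D : shf_data f r.
Hypothesis dimg : \dim {:g} = 6.

(* Closedness of f and r forces r(W, ., .) to have rank 2 on ker f(W, .). *)
Lemma rank1_bracket (W : g) : W != 0 -> (forall x y, exists s, lie x y = s *: W) ->
  forall x y : g, lie x y = 0.
Proof.
move=> W0 lieW.
have [fa [rP rl rr] nd pf _ df dr] := D.
have [v av] := nd W W0.
have rf := alt2_rules fa; have [_ fC] := fa.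
pose sg x y := f (lie x y) v / f W v.
have lieE x y : lie x y = sg x y *: W.
  by have [s e] := lieW x y; rewrite /sg e rf mulfK.
have dfE x y z : sg x y * f W z + sg y z * f W x + sg z x * f W y = 0.
  by have := df x y z; rewrite !lieE !rf.
have rW : alt2 (r W) by apply: alt3_intprod.
have rZ c x y : r (c *: W) x y = c * r W x y.
  have lin : linform (fun w => r w x y) by move=> a b d; apply: rP.
  by rewrite (linform_rules lin).
have drE x y z t : sg x y * r W z t - sg x z * r W y t + sg x t * r W y z + sg y z * r W x t
    - sg y t * r W x z + sg z t * r W x y = 0.
  by have := dr x y z t; rewrite !lieE !rZ.
have sgC x y : sg y x = - sg x y by rewrite /sg lieC rf mulNr.
move=> x0 y0; apply/eqP; apply/negPn/negP; rewrite lieE scaler_eq0 (negPf W0) orbF => s0.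
have sgP x : linform (sg x).
  by move=> c y z; rewrite /sg liePr !rf; ring.
(* Closedness of f says that sg /\ f(W, .) = 0, so sg vanishes on ker f(W, .). *)
have kerP x y : f W x = 0 -> f W y = 0 -> sg x y = 0.
  move=> ax ay; apply: (mulIf av); have := dfE x y v; rewrite ax ay; lra.
have [y ay ty] : exists2 y, f W y = 0 & sg v y != 0.
  have [u tu] : exists u, sg v u != 0.
    case: (eqVneq (sg v x0) 0) => [tx|]; last by exists x0.
    exists y0; apply: contraNneq s0 => ty; apply/eqP/(mulIf av).
    by have := dfE x0 y0 v; rewrite tx (sgC v) ty; lra.
  exists (u - (f W u / f W v) *: v); first by rewrite !rf divfK // subrr.
  rewrite !(linform_rules (sgP v)) (_ : sg v v = 0); first by rewrite mulr0 subr0.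
  by rewrite /sg liexx (linform0 ((linform_alt2 fa).2 v)) mul0r.
(* On ker f(W, .), closedness of r makes r(W, ., .) proportional to the wedge product of the 1-forms
   sg(v, .) and r(W, y, .). *)
have rWE z w : f W z = 0 -> f W w = 0 ->
    sg v y * r W z w = sg v z * r W y w - sg v w * r W y z.
  by move=> az aw; have := drE v y z w; rewrite (kerP y z) // (kerP y w) // (kerP z w) //; lra.
have [K [KP Kd]] := linform_ker ((linform_alt2 fa).1 W).
have dK : (5 <= \dim K)%N by have := Kd fullv; rewrite dimg capfv; lia.
have WK : W \in K by rewrite KP (alt2xx W fa).
have sub0 : {subset [:: W] <= K} by move=> z; rewrite inE => /eqP->.
have fr1 : free [:: W] by rewrite seq1_free.
have [z1 z1K fr2] := free_extend fr1 sub0 (leq_trans (isT : 1 < 5)%N dK).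
have sub1 : {subset [:: W; z1] <= K} by move=> z; rewrite !inE => /orP[] /eqP->.
have [z2 z2K fr3] := free_extend fr2 sub1 (leq_trans (isT : 2 < 5)%N dK).
have sub2 : {subset [:: W; z1; z2] <= K} by move=> z; rewrite !inE => /or3P[] /eqP->.
have [z3 z3K fr4] := free_extend fr3 sub2 (leq_trans (isT : 3 < 5)%N dK).
have sub3 : {subset [:: W; z1; z2; z3] <= K} by move=> z; rewrite !inE => /or4P[] /eqP->.
have [z4 z4K fr5] := free_extend fr4 sub3 (leq_trans (isT : 4 < 5)%N dK).
move: z1K z2K z3K z4K; rewrite !KP => /eqP a1 /eqP a2 /eqP a3 /eqP a4.
have /eqP[] := pf W z1 z2 z3 z4 fr5 a1 a2 a3 a4.
have E12 := rWE _ _ a1 a2; have E13 := rWE _ _ a1 a3; have E14 := rWE _ _ a1 a4.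
have E23 := rWE _ _ a2 a3; have E24 := rWE _ _ a2 a4; have E34 := rWE _ _ a3 a4.
(* Multiplying by (sg v y)^2 allows [rWE] in both factors of each term; the Pfaffian of a
   decomposable form is zero. *)
apply: (mulfI ty); apply: (mulfI ty); rewrite !mulr0.
transitivity ((sg v y * r W z1 z2) * (sg v y * r W z3 z4)
  - (sg v y * r W z1 z3) * (sg v y * r W z2 z4)
  + (sg v y * r W z1 z4) * (sg v y * r W z2 z3)); first by rewrite /pfaff; ring.
by rewrite E12 E13 E14 E23 E24 E34; ring.
Qed.

(** Modulo x, ker f(x, .) has dimension 4, and a nondegenerate 2-form there has no isotropic
    subspace of dimension 3 such as the span of y, W1, W2. *)
Lemma isotropic_contradiction x y W1 W2 : free [:: x; y; W1; W2] ->
  f x y = 0 -> f x W1 = 0 -> f x W2 = 0 -> r x y W1 = 0 -> r x y W2 = 0 -> r x W1 W2 = 0 ->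
  False.
Proof.
have [fa _ _ pf _ _ _] := D.
move=> fr xy x1 x2 xy1 xy2 x12.
have [K [KP Kd]] := linform_ker ((linform_alt2 fa).1 x).
have dK : (5 <= \dim K)%N by have := Kd fullv; rewrite dimg capfv; lia.
have sub : {subset [:: x; y; W1; W2] <= K}.
  by move=> z; rewrite !inE KP => /or4P[] /eqP->; rewrite ?(alt2xx x fa) ?xy ?x1 ?x2.
have [v vK fr5] := free_extend fr sub dK.
move: vK; rewrite KP => /eqP xv; have /eqP[] := pf x y W1 W2 v fr5 xy x1 x2 xv.
by rewrite /pfaff xy1 xy2 x12; ring.
Qed.

Section DirectSum.
Variables (g1 g2 : {vspace g}).
Hypotheses (sumg : lie_direct_sum g1 g2) (dimg2 : \dim g2 = 2).

Lemma lie_mem1 x y : x \in g1 -> lie y x \in g1.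
Proof. by move=> xg; have [/subvP i1 _ _ _] := sumg; apply/i1/memv_lie; rewrite ?memvf. Qed.

Lemma lie_mem2 x y : x \in g2 -> lie y x \in g2.
Proof. by move=> xg; have [_ /subvP i2 _ _] := sumg; apply/i2/memv_lie; rewrite ?memvf. Qed.

Lemma lie12 x y : x \in g1 -> y \in g2 -> lie x y = 0.
Proof.
move=> x1 y2; apply/eqP; rewrite -memv0; have [_ _ _ <-] := sumg.
by rewrite memv_cap lie_mem2 // lieC memvN lie_mem1.
Qed.

Lemma direct_sum_decomp x : exists x1 x2, [/\ x1 \in g1, x2 \in g2 & x = x1 + x2].
Proof.
have [_ _ eg _] := sumg; have := memvf x; rewrite -eg => /memv_addP[x1 h1 [x2 h2 e]].
by exists x1, x2.
Qed.

(** If w = [u,v] = a u + b v is nonzero, then [u,w] = b w and [v,w] = - a w. So e6 = w, and e5 is u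
    or v according to which coefficient is nonzero. *)
Lemma lie_plane_basis : exists e5 e6 eps,
  [/\ e5 \in g2, e6 \in g2, free [:: e5; e6] & lie e5 e6 = eps *: e6].
Proof.
have sub0 : {subset [::] <= g2} by [].
have [|u ug fu] := free_extend (nil_free g) sub0; first by rewrite dimg2.
have subu : {subset [:: u] <= g2} by move=> z; rewrite inE => /eqP->.
have [|v vg fuv] := free_extend fu subu; first by rewrite dimg2.
have sub : {subset [:: u; v] <= g2} by move=> z; rewrite !inE => /orP[] /eqP->.
have spang2 : (g2 <= <<[:: u; v]>>)%VS.
  have sub' : (<<[:: u; v]>> <= g2)%VS by apply/span_subvP.
  by rewrite -(geq_leqif (dimv_leqif_sup sub')) (eqP fuv) dimg2.
have frW (e w : g) c : w != 0 -> c != 0 -> lie e w = c *: w -> free [:: e; w].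
  move=> w0 c0 ew; rewrite free_cons seq1_free w0 andbT span_seq1; apply/vlineP => -[a ea].
  move: ew; rewrite ea lieC linearZ /= liexx scaler0 oppr0 => /esym/eqP.
  by rewrite scaler_eq0 (negPf w0) (negPf c0).
have [uv0|uv0] := eqVneq (lie u v) 0.
  by exists u, v, 0; rewrite uv0 scale0r; split.
have wg := lie_mem2 u vg.
have [a [y /span_consP[b [z]]]] := span_consP (subvP spang2 _ wg).
rewrite span_nil memv0 => /eqP-> ->; rewrite addr0 => wE.
have uw : lie u (lie u v) = b *: lie u v.
  by rewrite {1}wE linearD !linearZ /= liexx scaler0 add0r.
have vw : lie v (lie u v) = - a *: lie u v.
  by rewrite {1}wE linearD !linearZ /= liexx scaler0 addr0 lieC scalerN scaleNr.
have [b0|b0] := eqVneq b 0; last by exists u, (lie u v), b; split=> //; apply: (frW _ _ b).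
exists v, (lie u v), (- a); split=> //; apply: (frW _ _ (- a)) => //.
by rewrite oppr_eq0; apply: contraNneq uv0 => a0; rewrite wE a0 b0 !scale0r addr0.
Qed.

Section Basis.
Variables (e5 e6 : g) (eps : R).
Hypotheses (e5g : e5 \in g2) (e6g : e6 \in g2) (fr56 : free [:: e5; e6]).
Hypothesis lie56 : lie e5 e6 = eps *: e6.

Lemma plane_coord x : x \in g2 -> exists a b, x = a *: e5 + b *: e6.
Proof.
have sub : (<<[:: e5; e6]>> <= g2)%VS.
  by apply/span_subvP => z; rewrite !inE => /orP[] /eqP->.
have sp : (g2 <= <<[:: e5; e6]>>)%VS.
  by rewrite -(geq_leqif (dimv_leqif_sup sub)) (eqP fr56) dimg2.
move=> /(subvP sp) /span_consP[a [y /span_consP[b [z]]]]; rewrite span_nil memv0 => /eqP-> ->.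
by rewrite addr0 => ->; exists a, b.
Qed.

(** In d f (e5, e6, x) = 0 only f([e5,e6], x) survives, because x commutes with g2. *)
Lemma eps_pairing0 x : x \in g1 -> eps * f x e6 = 0.
Proof.
move=> xg; have [fa _ _ _ _ df _] := D; have rf := alt2_rules fa; have [_ fC] := fa.
have := df e5 e6 x; rewrite lie56 (lieC x e6) !lie12 // oppr0 !rf.
have f0 y : f 0 y = 0 by apply: (linform0 ((linform_alt2 fa).2 y)).
by rewrite !f0 !addr0 => h; rewrite fC mulrN h oppr0.
Qed.

Lemma isotropic_abelian : f e5 e6 = 0 -> forall x y : g, lie x y = 0.
Proof.
move=> c0; have [fa ra nd pf _ df dr] := D; have rf := alt2_rules fa; have [_ fC] := fa.
have [rP rl rr] := ra.
have e60 : e6 != 0 by move: fr56; rewrite !free_cons => /and3P[_ + _]; rewrite span_nil memv0.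
have f0 y : f 0 y = 0 by apply: (linform0 ((linform_alt2 fa).2 y)).
(* e6 pairs nontrivially with some vector, hence by [c0] with its component in g1, and
   [eps_pairing0] applies to that component. *)
have eps0 : eps = 0.
  have [z] := nd e6 e60; have [x [y [xg yg ->]]] := direct_sum_decomp z.
  have [a [b ->]] := plane_coord yg; rewrite !rf (fC e5 e6) c0 (alt2xx e6 fa) oppr0 !mulr0 !addr0.
  move=> ex; have := eps_pairing0 xg; rewrite fC mulrN => /eqP.
  by rewrite oppr_eq0 mulf_eq0 (negPf ex) orbF => /eqP.
have central z : z \in g2 -> forall x, lie z x = 0.
  move=> zg x; have [x1 [x2 [x1g x2g ->]]] := direct_sum_decomp x.
  have [a [b ->]] := plane_coord zg; have [a' [b' ->]] := plane_coord x2g.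
  rewrite !(lieDr, lieDl, lieZl, lieZr) !(lieC x1) !(lie12 x1g) // !liexx (lieC e5 e6) lie56 eps0.
  by rewrite !(scale0r, scaler0, oppr0, addr0).
have centralr z x : z \in g2 -> lie x z = 0 by move=> zg; rewrite lieC central ?oppr0.
have lie_g1 x y : lie x y \in g1.
  have [x1 [x2 [x1g x2g ->]]] := direct_sum_decomp x.
  by rewrite lieDl (central x2) // addr0 lieC memvN lie_mem1.
have rll u v : r u u v = 0 by have := rl u u v; lra.
have r0 y z : r 0 y z = 0.
  have lin : linform (fun x => r x y z) by move=> c u v; apply: rP.
  exact: (linform0 lin).
(* With g2 central, closedness of f and r makes every bracket orthogonal to g2 for f and annihilated
   by r(e5, e6, .). *)
have fe z x y : z \in g2 -> f z (lie x y) = 0.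
  move=> zg; have := df x y z; rewrite (centralr z) // (central z) // !f0 !addr0 [f z _]fC => ->.
  by rewrite oppr0.
have re x y : r e5 e6 (lie x y) = 0.
  have := dr x y e5 e6; rewrite !(centralr e5) ?(centralr e6) // !r0 !(addr0, subr0).
  by move=> h; rewrite rr rl opprK.
case: (pselect (exists x0 y0 : g, lie x0 y0 <> 0)) => [[x0 [y0 /eqP W0]]|nW]; last first.
  by move=> x y; apply: contrapT => xy; apply: nW; exists x, y.
set W := lie x0 y0 in W0; apply: (rank1_bracket W0) => x y.
case: (boolP (free [:: lie x y; W])) => [fW|]; last first.
  by rewrite free_cons seq1_free W0 andbT negbK span_seq1 => /vlineP[s ->]; exists s.
have f4 u v : free [:: u; v] -> u \in g2 -> v \in g2 -> free [:: u; v; lie x y; W].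
  move=> uv ug vg; apply: (free_cat2 (s := [:: u; v]) uv fW (U := g2) (W := g1)).
  - by move=> z; rewrite !inE => /orP[] /eqP->.
  - by move=> z; rewrite !inE => /orP[] /eqP->; apply: lie_g1.
  - by have [_ _ _ <-] := sumg; rewrite capvC.
have [A0|A0] := eqVneq (r e5 (lie x y) W) 0.
  by case: (isotropic_contradiction (f4 _ _ fr56 e5g e6g)); rewrite ?fe ?re.
(* The coefficients make r(B e5 - A e6, ., .) vanish on the pair [lie x y], W. *)
pose A := r e5 (lie x y) W; pose B := r e6 (lie x y) W.
have fr' : free [:: B *: e5 - A *: e6; e5].
  apply/free2P => a b e; have [] := (free2P _ _ fr56) (a * B + b) (- (a * A)).
    by rewrite -e scalerBr !scalerA scalerDl scaleNr addrAC.
  move=> e1 /eqP; rewrite oppr_eq0 mulf_eq0 (negPf A0) orbF => /eqP a0.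
  by move: e1; rewrite a0 mul0r add0r.
have xg : B *: e5 - A *: e6 \in g2 by rewrite memvB ?memvZ.
have rx u v : r (B *: e5 - A *: e6) u v = B * r e5 u v - A * r e6 u v.
  have lin : linform (fun x => r x u v) by move=> c p q; apply: rP.
  by rewrite !(linform_rules lin).
case: (isotropic_contradiction (f4 _ _ fr' xg e5g)); rewrite ?fe // ?rx.
- by rewrite !rf (alt2xx e5 fa) (fC e5 e6) c0; ring.
- by rewrite rll (rl e5 e6) re; ring.
- by rewrite rll (rl e5 e6) re; ring.
- by rewrite /A /B; ring.
Qed.

(** * The case where f is nondegenerate on g2 *)

Section Nondegenerate.
Hypothesis c0 : f e5 e6 != 0.

Lemma orthogonal_space : exists H : {vspace g},
  [/\ forall x, (x \in H) = (f e5 x == 0) && (f e6 x == 0), \dim H = 4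
    & (H :&: <<[:: e5; e6]>> = 0)%VS].
Proof.
have [fa _ _ _ _ _ _] := D; have rf := alt2_rules fa; have [_ fC] := fa.
have [K5 [K5P K5d]] := linform_ker ((linform_alt2 fa).1 e5).
have [K6 [K6P K6d]] := linform_ker ((linform_alt2 fa).1 e6).
have HP x : (x \in (K5 :&: K6)%VS) = (f e5 x == 0) && (f e6 x == 0).
  by rewrite memv_cap K5P K6P.
have H0 : (K5 :&: K6 :&: <<[:: e5; e6]>> = 0)%VS.
  apply/eqP; rewrite -subv0; apply/subvP => x; rewrite memv_cap HP.
  move=> /andP[/andP[/eqP x5 /eqP x6] /span_consP[a [y /span_consP[b [z]]]]].
  rewrite span_nil memv0 => /eqP-> ->; rewrite addr0 => xE.
  move: x5 x6; rewrite xE !rf !(alt2xx _ fa) (fC e5 e6) => x5 x6.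
  have a0 : a = 0 by apply: (mulIf c0); lra.
  have b0 : b = 0 by apply: (mulIf c0); lra.
  by rewrite a0 b0 !scale0r addr0 mem0v.
exists (K5 :&: K6)%VS; split=> //; apply/eqP; rewrite eqn_leq; apply/andP; split.
  have := dimvS (subvf (K5 :&: K6 + <<[:: e5; e6]>>)); rewrite dimg.
  by rewrite dimv_disjoint_sum // (eqP fr56) /=; lia.
by have := K5d fullv; have := K6d K5; rewrite dimg capfv; lia.
Qed.

Lemma nondegenerate_abelian : forall x y : g, lie x y = 0.
Proof.
have [fa ra nd pf wd df dr] := D; have rf := alt2_rules fa; have [_ fC] := fa.
have [rP rl rr] := ra.
have [H [HP dimH H0]] := orthogonal_space.
have f5 x : x \in H -> f e5 x = 0 by rewrite HP => /andP[/eqP].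
have f6 x : x \in H -> f e6 x = 0 by rewrite HP => /andP[_ /eqP].
have r1 u v : linform (fun x => r x u v) by move=> c x y; apply: rP.
have r2 u v : linform (fun x => r u x v) by move=> c x y; rewrite !(rl _ u) rP; ring.
have r3 u v : linform (fun x => r u v x) by move=> c x y; rewrite !(rr u _ v) (r2 u v); ring.
pose ee := [:: e5; e6].
have eeP : {subset ee <= <<ee>>%VS} by move=> z; apply: memv_span.
have fr_HZ s : free s -> {subset s <= H} -> free (s ++ ee).
  by move=> fs sH; apply: (free_cat2 fs fr56 sH eeP H0).
have dec y : exists a b, y - (a *: e5 + b *: e6) \in H.
  exists (f y e6 / f e5 e6), (- (f y e5 / f e5 e6)).
  rewrite HP !rf !(alt2xx _ fa) (fC e5 e6) (fC y e5) (fC y e6).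
  by apply/andP; split; apply/eqP; field.
have fp y : exists2 p, p \in H & forall x, x \in H -> f x p = f x y.
  have [a [b pH]] := dec y; exists (y - (a *: e5 + b *: e6)) => // x xH.
  by rewrite !rf (fC e5 x) (fC e6 x) (f5 x xH) (f6 x xH); ring.
have tri : triple H f (fun x y => r x y e5) (fun x y => r x y e6) (fun x => r x e5 e6).
  split=> //.
  - move=> x xH /nd[y fxy]; have [p pH pE] := fp y.
    by exists p => //; rewrite pE.
  - move=> x xH x0 gx.
    (* n1 and n2 complete x in H within ker f(x, .). As gam x = 0, the Pfaffian of r(x, ., .) on n1,
       n2, e5, e6 reduces to the required determinant up to sign. *)
    have [K [KP Kd]] := linform_ker ((linform_alt2 fa).1 x).
    have dK : (3 <= \dim (H :&: K))%N by have := Kd H; rewrite dimH; lia.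
    have xK : x \in (H :&: K)%VS by rewrite memv_cap xH KP (alt2xx x fa) eqxx.
    have sub1 : {subset [:: x] <= (H :&: K)%VS} by move=> z; rewrite inE => /eqP->.
    have frx : free [:: x] by rewrite seq1_free.
    have [n1 n1K fr2] := free_extend frx sub1 (leq_trans (isT : 1 < 3)%N dK).
    have sub2 : {subset [:: x; n1] <= (H :&: K)%VS} by move=> z; rewrite !inE => /orP[] /eqP->.
    have [n2 n2K fr3] := free_extend fr2 sub2 (leq_trans (isT : 2 < 3)%N dK).
    move: n1K n2K; rewrite !memv_cap !KP => /andP[n1H /eqP xn1] /andP[n2H /eqP xn2].
    exists n1, n2; split=> //.
    have sub3 : {subset [:: x; n1; n2] <= H} by move=> z; rewrite !inE => /or3P[] /eqP->.
    have := pf x n1 n2 e5 e6 (fr_HZ _ fr3 sub3) xn1 xn2.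
    rewrite (fC e5) (fC e6) f5 // f6 // oppr0 => /(_ erefl erefl).
    by apply: contraNneq => e; rewrite /pfaff gx; apply/eqP; lra.
  - move=> a b x y z t ab fr xH yH zH tH.
    pose u := a *: e5 + b *: e6.
    have sub4 : {subset [:: x; y; z; t] <= H} by move=> v; rewrite !inE => /or4P[] /eqP->.
    have fru : free [:: u; x; y; z; t].
      rewrite free_cons fr andbT; apply/negP => uH.
      have : u \in (H :&: <<ee>>)%VS.
        rewrite memv_cap (subvP _ _ uH) /=; last by apply/span_subvP.
        by rewrite memvD ?memvZ ?eeP ?inE ?eqxx ?orbT.
      rewrite H0 memv0 => /eqP u0; have [a0 b0] := (free2P _ _ fr56) _ _ u0.
      by move: ab; rewrite a0 b0 eqxx.
    have fu v : v \in H -> f u v = 0 by move=> vH; rewrite /u !rf f5 // f6 //; ring.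
    have := pf u x y z t fru (fu x xH) (fu y yH) (fu z zH) (fu t tH).
    have ru v w : r u v w = a * r v w e5 + b * r v w e6.
      have e := linform_rules (r1 v w).
      by rewrite /u !e !(rl v e5) !(rl v e6) !(rr v w e5) !(rr v w e6); ring.
    by rewrite /pfaff !ru.
  - move=> x y z t xH yH zH tH.
    have := wd x y z t e6; have := wd x y z t e5; rewrite /wedge23 /wedge22.
    rewrite !(fC e5) !(fC e6) !f5 // !f6 // => w5 w6.
    by split; [rewrite -[RHS]w5|rewrite -[RHS]w6]; ring.
have [kap [N1 [N2 [N3 [h0 [h1 [h2 [h3 fr]]]]]]]] := frame_exists tri.
have f0 y : f 0 y = 0 by apply: (linform0 ((linform_alt2 fa).2 y)).
have r0 u v : r 0 u v = 0 by apply: (linform0 (r1 u v)).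
have rZ c x u v : r (c *: x) u v = c * r x u v by apply: (linform_rules (r1 u v)).1.2.
have r1N x u v : r (- x) u v = - r x u v by apply: (linform_rules (r1 u v)).2.
have rll u v : r u u v = 0 by have := rl u u v; lra.
have rr2 u v : r u v v = 0 by have := rr u v v; lra.
have r6 u v : r e6 u v = r u v e6 by rewrite (rl u e6) (rr u v) opprK.
(* If a is the e5-coefficient of x, then [x,e6] = a eps e6. Multiplying f(e6, x) = 0 by eps and
   using [eps_pairing0] gives eps a = 0. *)
have e6x x : x \in H -> lie x e6 = 0.
  move=> xH; have [x1 [x2 [x1g x2g xE]]] := direct_sum_decomp x.
  have [a [b x2E]] := plane_coord x2g.
  have ea : eps * a = 0.
    have := f6 x xH; rewrite xE x2E !rf (alt2xx _ fa) (fC e5 e6) (fC x1 e6) => e.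
    by apply: (mulIf c0); have := eps_pairing0 x1g; have := congr1 ( *%R eps) e; lra.
  rewrite xE x2E !lieDl !lieZl (lie12 x1g e6g) lie56 liexx scaler0.
  by rewrite addr0 add0r scalerA mulrC ea scale0r.
(* The coefficient of e6 in [e5,x], read off by a pairing so that k is linear on all of g. *)
pose k x := f (lie e5 x) e5 / f e6 e5.
have c0' : f e6 e5 != 0 by rewrite fC oppr_eq0.
have e5x x : x \in H -> lie e5 x = k x *: e6 /\ (eps = 0 -> k x = 0).
  move=> xH; have [x1 [x2 [x1g x2g xE]]] := direct_sum_decomp x.
  have [a [b x2E]] := plane_coord x2g.
  have lE : lie e5 x = (b * eps) *: e6.
    by rewrite xE x2E !lieDr !lieZr lieC (lie12 x1g e5g) lie56 liexx oppr0 scaler0 !add0r scalerA.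
  by rewrite /k lE rf mulfK //; split=> // ->; rewrite mulr0.
have klin : linform k.
  by move=> c x y; rewrite /k liePr !rf mulrDl mulrA.
have xe5 x : x \in H -> lie x e5 = - k x *: e6.
  by move=> xH; rewrite lieC (e5x x xH).1 scaleNr.
(* Brackets of H with e5 and e6 are multiples of e6, hence orthogonal to H; closedness of f then
   gives f([x,y], e_i) = 0. *)
have Hlie x y : x \in H -> y \in H -> lie x y \in H.
  move=> xH yH; rewrite HP (fC _ e5) (fC _ e6) !oppr_eq0.
  have := df x y e5; have := df x y e6; rewrite (lieC _ e6) !e6x // xe5 // (e5x x xH).1.
  rewrite oppr0 !rf (f6 x xH) (f6 y yH) !mulr0 !addr0.
  by rewrite !f0 !addr0 => -> ->; rewrite eqxx.
(* In the Jacobi identity for e5, x, y, the other two terms are brackets of H with multiples of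
   e6. *)
have klie x y : x \in H -> y \in H -> k (lie x y) = 0.
  move=> xH yH; have := lie_jacobi e5 x y.
  rewrite xe5 // (e5x x xH).1 !lieZr.
  rewrite !e6x // !scaler0 !addr0 => e.
  by rewrite /k e f0 mul0r.
have d1 x y z : x \in H -> y \in H -> z \in H ->
    f (lie x y) z + f (lie y z) x + f (lie z x) y = 0 by move=> *; apply: df.
have d3 x y z : x \in H -> y \in H -> z \in H ->
    r (lie x y) z e6 + r (lie y z) x e6 + r (lie z x) y e6 = 0.
  move=> xH yH zH; have := dr x y z e6; rewrite !e6x // !r0 (lieC x z) r1N.
  by move=> e; lra.
(* The brackets with e5 in d r (x, y, z, e5) = 0 produce k /\ w3; the part with kap vanishes by
   [d3]. *)
have d2 x y z : x \in H -> y \in H -> z \in H ->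
    (r (lie x y) z e5 - kap * r (lie x y) z e6) + (r (lie y z) x e5 - kap * r (lie y z) x e6)
    + (r (lie z x) y e5 - kap * r (lie z x) y e6) =
    k x * r y z e6 + k y * r z x e6 + k z * r x y e6.
  move=> xH yH zH; have e3 := congr1 ( *%R kap) (d3 x y z xH yH zH).
  rewrite (lieC x z) r1N in e3.
  have := dr x y z e5; rewrite !xe5 // (lieC x z) !r1N !rZ.
  by rewrite !r6 (rl x z) => e; lra.
(* The bracket [e5,e6] = eps e6 in d r (x, y, e5, e6) = 0 yields the right-hand side, so eps w3 is
   exact and s = - eps in [frame_conclusion]. *)
have glie x y : x \in H -> y \in H -> r (lie x y) e5 e6 = (- eps) * r x y e6.
  move=> xH yH; have := dr x y e5 e6.
  rewrite lie56 (xe5 x xH) (xe5 y yH) (e6x x xH) (e6x y yH) !rZ !r0.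
  by rewrite !r6 !rr2 => e; lra.
have epsk : - eps = 0 -> forall x, x \in H -> k x = 0.
  by move=> /eqP; rewrite oppr_eq0 => /eqP e0 x xH; apply: (e5x x xH).2.
have [/eqP ] := frame_conclusion fr Hlie d1 d2 d3 klin (r1 e5 e6) klie glie epsk.
rewrite oppr_eq0 => /eqP e0 ab x y.
have e5x0 z : z \in H -> lie e5 z = 0.
  by move=> zH; have [-> /(_ e0)->] := e5x z zH; rewrite scale0r.
have [a [b hx]] := dec x; have [a' [b' hy]] := dec y.
rewrite -(subrK (a *: e5 + b *: e6) x) -(subrK (a' *: e5 + b' *: e6) y).
move: (x - _) (y - _) hx hy => u v uH vH.
rewrite !(lieDl, lieDr, lieZl, lieZr) ab // (lieC e5 u) (lieC v e6) (lieC e5 e6) lie56 e0.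
rewrite (e5x0 u uH) (e5x0 v vH) (e6x u uH) (e6x v vH) !liexx.
by rewrite !(scale0r, oppr0, scaler0, addr0).
Qed.

End Nondegenerate.
End Basis.

Lemma shf_abelian (x y : g) : lie x y = 0.
Proof.
have [e5 [e6 [eps [e5g e6g fr56 lie56]]]] := lie_plane_basis.
have [c0|c0] := eqVneq (f e5 e6) 0.
  exact: (isotropic_abelian e5g e6g fr56 lie56 c0).
exact: (nondegenerate_abelian e5g e6g fr56 lie56 c0).
Qed.

End DirectSum.
End Data.

Theorem proposition4p2 (R : realType) (g : lieAlgType R) (g1 g2 : {vspace g})
    (dimg : \dim {:g} = 6) (nilg : ~ lie_nilpotent g)
    (sumg : lie_direct_sum g1 g2) (dimg1 : \dim g1 = 4) (dimg2 : \dim g2 = 2) :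
  ~ exists (vol : kform g 6) (F : kform g 2) (rho : kform g 3),
      volume_form vol /\ symplectic_half_flat vol F rho.
Proof.
(* [lower_central] is g at index 0, so the index 1 stands for [g,g], which is zero once g is
   abelian. *)
move=> [vol [F [rho [volP shf]]]]; apply: nilg; exists 1%N.
have ab := shf_abelian (symplectic_half_flat_data dimg volP shf) dimg sumg dimg2.
apply/eqP; rewrite -subv0; apply/span_subvP => _ /allpairsP[[x y] [_ _ ->]] /=.
by rewrite ab mem0v.
Qed.
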